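(* Let $(R,\mathfrak m)$ be a Noetherian local ring of dimension $d\ge1$ with infinite residue field. Let $I$ be an $\mathfrak m$-primary ideal and $J$ a minimal reduction of $I$. Then there exists a minimal reduction $Q$ of $I$ such that \[ \operatorname{red}_Q(I)\le\max\{d\cdot\lambda(R/J)-2d+1,\;0\}. \]
   Context: $\lambda$ denotes length. A reduction of $I$ is an ideal $Q\subseteq I$ with $I^{r+1}=QI^r$ for some $r\ge0$; a minimal reduction is one minimal with respect to inclusion (for infinite residue field it is generated by $d$ elements forming a system of parameters). $\operatorname{red}_Q(I)$ is the least $r\ge0$ with $I^{r+1}=QI^r$. *)

(* Defs.v *)
From HB Require Import structures.
From mathcomp Require Import all_boot all_order all_algebra.
Set Implicit Arguments. Unset Strict Implicit. Unset Printing Implicit Defensive.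
Import GRing.Theory.
Local Open Scope ring_scope.

Section CommAlg.
Variable R : comNzRingType.

Definition ideal_sub (I J : R -> Prop) : Prop := forall x, I x -> J x.
Definition ideal_eq (I J : R -> Prop) : Prop := forall x, I x <-> J x.

Definition is_ideal (I : R -> Prop) : Prop :=
  [/\ I 0, (forall x y, I x -> I y -> I (x + y)) & (forall r x, I x -> I (r * x))].

Definition gen_ideal (S : R -> Prop) : R -> Prop :=
  fun x => forall I, is_ideal I -> ideal_sub S I -> I x.

Definition ideal_mul (I J : R -> Prop) : R -> Prop :=
  gen_ideal (fun x => exists a b, [/\ I a, J b & x = a * b]).

Fixpoint ideal_pow (I : R -> Prop) (n : nat) : R -> Prop :=
  match n with
  | O => fun _ => True
  | S n' => ideal_mul I (ideal_pow I n')
  end.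

Definition is_prime_ideal (P : R -> Prop) : Prop :=
  [/\ is_ideal P, ~ P 1 & forall a b, P (a * b) -> P a \/ P b].

Definition noetherian : Prop :=
  forall I, is_ideal I -> exists s : seq R, ideal_eq I (gen_ideal (fun x => x \in s)).

Definition local_with_max (m : R -> Prop) : Prop :=
  [/\ is_ideal m, ~ m 1 & forall I, is_ideal I -> ~ I 1 -> ideal_sub I m].

Definition prime_chain (P : nat -> R -> Prop) (n : nat) : Prop :=
  (forall i, (i <= n)%N -> is_prime_ideal (P i)) /\
  (forall i, (i < n)%N -> ideal_sub (P i) (P i.+1) /\ ~ ideal_sub (P i.+1) (P i)).

Definition krull_dim (d : nat) : Prop :=
  (exists P, prime_chain P d) /\ ~ (exists P, prime_chain P d.+1).

(* strict chain of ideals J <= C 0 < C 1 < ... < C n (submodules of R/J) *)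
Definition ideal_chain_over (J : R -> Prop) (C : nat -> R -> Prop) (n : nat) : Prop :=
  [/\ (forall i, (i <= n)%N -> is_ideal (C i)), ideal_sub J (C 0%N) &
      (forall i, (i < n)%N -> ideal_sub (C i) (C i.+1) /\ ~ ideal_sub (C i.+1) (C i))].

Definition length_quot (J : R -> Prop) (l : nat) : Prop :=
  (exists C, ideal_chain_over J C l) /\ ~ (exists C, ideal_chain_over J C l.+1).

Definition primary_to (m I : R -> Prop) : Prop :=
  is_ideal I /\ forall x, m x <-> exists n, I (x ^+ n).

(* the residue field R/m is infinite: no finite list of elements represents
   all residue classes *)
Definition infinite_residue (m : R -> Prop) : Prop :=
  forall s : seq R, exists x, forall y, y \in s -> ~ m (x - y).

Definition is_reduction (Q I : R -> Prop) : Prop :=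
  [/\ is_ideal Q, ideal_sub Q I &
      exists r, ideal_eq (ideal_pow I r.+1) (ideal_mul Q (ideal_pow I r))].

Definition minimal_reduction (Q I : R -> Prop) : Prop :=
  is_reduction Q I /\
  forall Q', is_reduction Q' I -> ideal_sub Q' Q -> ideal_sub Q Q'.

Definition reduction_number (Q I : R -> Prop) (r : nat) : Prop :=
  ideal_eq (ideal_pow I r.+1) (ideal_mul Q (ideal_pow I r)) /\
  forall s, (s < r)%N -> ~ ideal_eq (ideal_pow I s.+1) (ideal_mul Q (ideal_pow I s)).

End CommAlg.

(* Main.v *)
Require Import Defs.
From HB Require Import structures.
From mathcomp Require Import all_boot all_order all_algebra.
From mathcomp Require Import boolp ring.
Set Implicit Arguments. Unset Strict Implicit. Unset Printing Implicit Defensive.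
Import GRing.Theory.
Local Open Scope ring_scope.

(* Let F be the fiber cone of I, with components I^n/mI^n. Writing J = (x_1, ..., x_d)
   and E = (x_1, ..., x_{d-1})^n, the ring R/E is one-dimensional and
   R/(E + (x_d)) has length at most l C(n+d-2, d-1), where l is the length of R/J.
   Hence dim F_n <= l C(n+d-2, d-1) + C(n+d-2, d-2), which is less than C(n+d, d) for
   n = d(l-2) + 2. By the theorem of Eakin and Sathaye there are then d elements
   q_1, ..., q_d of I with I^n = (q_1, ..., q_d) I^(n-1).

   The same two steps, applied to J and to high powers of a system of parameters
   lying in J, show that J is generated by d elements. Finally Q = (q_1, ..., q_d) is a
   minimal reduction because, by Krull's height theorem, no ideal generated by fewer
   than d elements is m-primary. *)

(** * Ideals of a Noetherian ring *)

(** The binomial bounds count monomials in given generators, so the generators of J must number d,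
    whereas minimality of J speaks only of inclusion. This is why Krull's theorems and systems of
    parameters enter. In the bound on dim F_n one summand counts the monomials that generate E. The
    other comes from the one-dimensional ring R/E: multiplication by y = x_d maps R/G onto yR/yG,
    which gives length(G/yG) <= length(R/yR) for an ideal G of finite colength. Krull's theorems use
    lengths over local rings R_P, the rest uses lengths over R. No localization or quotient module
    is built: the pair of ideals B, A of R stands for (A/B)_P, and an upper bound on its length is
    the absence of a chain of ideals between them. The infinite residue field is what lets q_1, ...,
    q_d meet finitely many generic conditions at once. *)

Section Ideals.
Variable R : comNzRingType.
Implicit Types (A B C K I P : R -> Prop) (x y g : R) (s : seq R).

Definition whole (_ : R) : Prop := True.
Definition isum A B x : Prop := exists a b, [/\ A a, B b & x = a + b].
Definition imul_elt g A x : Prop := exists2 a, A a & x = g * a.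
Definition principal g := imul_elt g whole.
Definition colon A g x : Prop := A (x * g).
Definition icap A B x : Prop := A x /\ B x.
Definition span s : R -> Prop := gen_ideal (fun x => x \in s).
(** The contraction to R of A R_P. Ideals of R_P correspond to the [saturated] ideals of R. *)
Definition sat P A x : Prop := exists2 u, ~ P u & A (u * x).
Definition saturated P A : Prop := forall u x, ~ P u -> A (u * x) -> A x.

Lemma id0 A : is_ideal A -> A 0. Proof. by case. Qed.
Lemma idD A x y : is_ideal A -> A x -> A y -> A (x + y).
Proof. by case=> _ h _; exact: h. Qed.
Lemma idMl A x y : is_ideal A -> A x -> A (y * x).
Proof. by case=> _ _ h; exact: h. Qed.
Lemma idMr A x y : is_ideal A -> A x -> A (x * y).
Proof. by move=> hA hx; rewrite mulrC; exact: idMl. Qed.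
Lemma idN A x : is_ideal A -> A x -> A (- x).
Proof. by move=> hA hx; rewrite -mulN1r; exact: idMl. Qed.
Lemma idB A x y : is_ideal A -> A x -> A y -> A (x - y).
Proof. by move=> hA hx hy; apply: idD => //; apply: idN. Qed.
Lemma id_sum A (T : finType) (F : T -> R) :
  is_ideal A -> (forall i, A (F i)) -> A (\sum_i F i).
Proof.
by move=> hA hF; apply: (big_ind A) => //; [exact: id0 | move=> x y; exact: idD].
Qed.
Lemma idDr A x y : is_ideal A -> A (x + y) -> A y -> A x.
Proof. by move=> hA hxy hy; rewrite -(addrK y x); apply: idB. Qed.

Lemma sub_refl A : ideal_sub A A. Proof. by []. Qed.
Lemma sub_trans B A C : ideal_sub A B -> ideal_sub B C -> ideal_sub A C.
Proof. by move=> h k x /h/k. Qed.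
Lemma not_sub A B : ~ ideal_sub A B -> exists2 x, A x & ~ B x.
Proof. by move/existsNP => [x /not_implyP[? ?]]; exists x. Qed.
Lemma ideal_one_whole A : is_ideal A -> A 1 -> ideal_sub whole A.
Proof. by move=> hA h1 x _; rewrite -[x]mulr1; apply: idMl. Qed.

Lemma whole_ideal : is_ideal whole. Proof. by []. Qed.
Lemma isum_ideal A B : is_ideal A -> is_ideal B -> is_ideal (isum A B).
Proof.
move=> hA hB; split.
- by exists 0, 0; rewrite addr0; split=> //; apply: id0.
- move=> _ _ [a [b [ha hb ->]]] [a' [b' [ha' hb' ->]]].
  by exists (a + a'), (b + b'); split; [exact: idD | exact: idD | rewrite addrACA].
- move=> r _ [a [b [ha hb ->]]].
  by exists (r * a), (r * b); split; [exact: idMl | exact: idMl | rewrite mulrDr].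
Qed.
Lemma isuml A B : is_ideal B -> ideal_sub A (isum A B).
Proof. by move=> hB x hx; exists x, 0; rewrite addr0; split=> //; apply: id0. Qed.
Lemma isumr A B : is_ideal A -> ideal_sub B (isum A B).
Proof. by move=> hA x hx; exists 0, x; rewrite add0r; split=> //; apply: id0. Qed.
Lemma isum_min A B C :
  is_ideal C -> ideal_sub A C -> ideal_sub B C -> ideal_sub (isum A B) C.
Proof. by move=> hC h k _ [a [b [/h ha /k hb ->]]]; apply: idD. Qed.
Lemma isum_mono A B A' B' :
  ideal_sub A A' -> ideal_sub B B' -> ideal_sub (isum A B) (isum A' B').
Proof. by move=> h k _ [a [b [/h ha /k hb ->]]]; exists a, b. Qed.

Lemma imul_elt_ideal g A : is_ideal A -> is_ideal (imul_elt g A).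
Proof.
move=> hA; split.
- by exists 0; [exact: id0 | rewrite mulr0].
- by move=> _ _ [a ha ->] [b hb ->]; exists (a + b); [exact: idD | rewrite mulrDr].
- by move=> r _ [a ha ->]; exists (r * a); [exact: idMl | rewrite mulrCA].
Qed.
Lemma principal_ideal g : is_ideal (principal g).
Proof. exact: imul_elt_ideal. Qed.
Lemma principal_gen g : principal g g.
Proof. by exists 1; rewrite ?mulr1. Qed.
Lemma principal_min g A : is_ideal A -> A g -> ideal_sub (principal g) A.
Proof. by move=> hA hg _ [a _ ->]; apply: idMr. Qed.
Lemma colon_ideal A g : is_ideal A -> is_ideal (colon A g).
Proof.
move=> hA; split; rewrite /colon.
- by rewrite mul0r; apply: id0.
- by move=> x y hx hy; rewrite mulrDl; apply: idD.
- by move=> r x hx; rewrite -mulrA; apply: idMl.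
Qed.
Lemma icap_ideal A B : is_ideal A -> is_ideal B -> is_ideal (icap A B).
Proof.
move=> hA hB; split.
- by split; apply: id0.
- by move=> x y [? ?] [? ?]; split; apply: idD.
- by move=> r x [? ?]; split; apply: idMl.
Qed.

Lemma gen_ideal_ideal (S : R -> Prop) : is_ideal (gen_ideal S).
Proof.
split.
- by move=> A hA _; apply: id0.
- by move=> x y hx hy A hA hS; exact: idD (hx A hA hS) (hy A hA hS).
- by move=> r x hx A hA hS; exact: idMl (hx A hA hS).
Qed.
Lemma gen_ideal_sub (S : R -> Prop) : ideal_sub S (gen_ideal S).
Proof. by move=> x hx A _ hS; apply: hS. Qed.
Lemma gen_ideal_min (S : R -> Prop) A :
  is_ideal A -> ideal_sub S A -> ideal_sub (gen_ideal S) A.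
Proof. by move=> hA hS x hx; exact: (hx A hA hS). Qed.

Lemma span_ideal s : is_ideal (span s). Proof. exact: gen_ideal_ideal. Qed.
Lemma span_in s x : x \in s -> span s x. Proof. exact: gen_ideal_sub. Qed.
Lemma span_min s A : is_ideal A -> (forall x, x \in s -> A x) -> ideal_sub (span s) A.
Proof. exact: gen_ideal_min. Qed.
Lemma span_cons x s : ideal_sub (span (x :: s)) (isum (principal x) (span s)).
Proof.
apply: span_min => [|y]; first exact: isum_ideal (principal_ideal _) (span_ideal _).
rewrite inE => /orP[/eqP ->|hy].
  exact: (isuml (span_ideal _) (principal_gen _)).
exact: (isumr (principal_ideal _) (span_in hy)).
Qed.

(* Membership with coefficients restricted to an ideal A: with A = R this
   describes the ideal generated by s, with A = P the product P * (s). *)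
Lemma comb_ideal A s : is_ideal A ->
  is_ideal (fun x => exists2 c : 'I_(size s) -> R, (forall i, A (c i)) &
                     x = \sum_i c i * s`_i).
Proof.
move=> hA; split.
- exists (fun=> 0); first by move=> _; exact: id0.
  by rewrite big1 // => i _; rewrite mul0r.
- move=> _ _ [c hc ->] [e he ->]; exists (fun i => c i + e i); first by move=> i; apply: idD.
  by rewrite -big_split; apply: eq_bigr => i _; rewrite mulrDl.
- move=> r _ [c hc ->]; exists (fun i => r * c i); first by move=> i; apply: idMl.
  by rewrite mulr_sumr; apply: eq_bigr => i _; rewrite mulrA.
Qed.

Lemma mul_span_comb A s x : is_ideal A -> ideal_mul A (span s) x ->
  exists2 c : 'I_(size s) -> R, (forall i, A (c i)) & x = \sum_i c i * s`_i.
Proof.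
move=> hA; apply: (gen_ideal_min (comb_ideal s hA)).
move=> _ [a [b [ha hb ->]]]; rewrite mulrC.
apply: (span_min (colon_ideal a (comb_ideal s hA)) _ hb) => y hy.
have hj : (index y s < size s)%N by rewrite index_mem.
exists (fun i => if i == Ordinal hj then a else 0).
  by move=> i; case: ifP => _ //; exact: id0.
rewrite (bigD1 (Ordinal hj)) //= eqxx big1 ?addr0 ?nth_index //; first by rewrite mulrC.
by move=> i /negbTE ->; rewrite mul0r.
Qed.

Lemma mul_ideal A B : is_ideal (ideal_mul A B). Proof. exact: gen_ideal_ideal. Qed.
Lemma mul_in A B x y : A x -> B y -> ideal_mul A B (x * y).
Proof. by move=> hx hy; apply: gen_ideal_sub; exists x, y. Qed.
Lemma mul_min A B C : is_ideal C -> (forall x y, A x -> B y -> C (x * y)) ->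
  ideal_sub (ideal_mul A B) C.
Proof. by move=> hC h; apply: gen_ideal_min => // _ [a [b [ha hb ->]]]; apply: h. Qed.
Lemma mul_mono A B A' B' : ideal_sub A A' -> ideal_sub B B' ->
  ideal_sub (ideal_mul A B) (ideal_mul A' B').
Proof.
by move=> h k; apply: mul_min; [exact: mul_ideal | move=> x y /h ? /k ?; apply: mul_in].
Qed.
Lemma mul_subr A B : is_ideal B -> ideal_sub (ideal_mul A B) B.
Proof. by move=> hB; apply: mul_min => // x y _; exact: idMl. Qed.
Lemma mul_subl A B : is_ideal A -> ideal_sub (ideal_mul A B) A.
Proof. by move=> hA; apply: mul_min => // x y hx _; exact: idMr. Qed.
Lemma mul_span s x : span s x -> ideal_mul whole (span s) x.
Proof. by move=> hx; rewrite -[x]mul1r; apply: mul_in. Qed.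
Lemma mulA_sub A B C :
  ideal_sub (ideal_mul A (ideal_mul B C)) (ideal_mul (ideal_mul A B) C).
Proof.
apply: mul_min; first exact: mul_ideal.
move=> x y hx hy; rewrite mulrC.
apply: (mul_min (colon_ideal x (mul_ideal _ _)) _ hy) => b c hb hc.
by rewrite /colon mulrC mulrA; apply: mul_in => //; apply: mul_in.
Qed.
Lemma mulC_sub A B : ideal_sub (ideal_mul A B) (ideal_mul B A).
Proof.
by apply: mul_min; [exact: mul_ideal | move=> x y hx hy; rewrite mulrC; apply: mul_in].
Qed.
Lemma mulA_sub' A B C :
  ideal_sub (ideal_mul (ideal_mul A B) C) (ideal_mul A (ideal_mul B C)).
Proof.
move=> x /mulC_sub /(mul_mono (@sub_refl _) (@mulC_sub _ _)) /mulA_sub /mulC_sub.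
exact: (mul_mono (@sub_refl _) (@mulC_sub _ _)).
Qed.

Lemma pow_ideal I n : is_ideal (ideal_pow I n).
Proof. by case: n => [|n] //=; exact: mul_ideal. Qed.
Lemma pow_in I n x : I x -> ideal_pow I n (x ^+ n).
Proof. by move=> hx; elim: n => //= n IH; rewrite exprS; apply: mul_in. Qed.
Lemma powS_sub I n : ideal_sub (ideal_pow I n.+1) (ideal_pow I n).
Proof. exact: mul_subr (pow_ideal _ _). Qed.
Lemma pow_mono I J n : ideal_sub I J -> ideal_sub (ideal_pow I n) (ideal_pow J n).
Proof. by move=> h; elim: n => //= n IH; apply: mul_mono. Qed.
Lemma powS_subl I n : is_ideal I -> ideal_sub (ideal_pow I n.+1) I.
Proof. by move=> hI; exact: mul_subl. Qed.
Lemma powD' I a b :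
  ideal_sub (ideal_mul (ideal_pow I a) (ideal_pow I b)) (ideal_pow I (a + b)).
Proof.
elim: a => [|a IH] x; first by rewrite add0n; apply: mul_subr; exact: pow_ideal.
by rewrite addSn => /mulA_sub' /(mul_mono (@sub_refl _) IH).
Qed.

Lemma sat_ideal P A : is_prime_ideal P -> is_ideal A -> is_ideal (sat P A).
Proof.
move=> [hP P1 hM] hA; split.
- by exists 1 => //; rewrite mulr0; exact: id0.
- move=> x y [u hu hx] [v hv hy]; exists (u * v); first by case/hM.
  by rewrite mulrDr {1}[u * v]mulrC -!mulrA; apply: idD => //; apply: idMl.
- by move=> r x [u hu hx]; exists u => //; rewrite mulrCA; apply: idMl.
Qed.
Lemma sat_sub P A : is_prime_ideal P -> ideal_sub A (sat P A).
Proof. by move=> [_ P1 _] x hx; exists 1 => //; rewrite mul1r. Qed.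
Lemma sat_saturated P A : is_prime_ideal P -> saturated P (sat P A).
Proof.
move=> [_ _ hM] u x hu [v hv h]; exists (v * u); first by case/hM.
by rewrite -mulrA.
Qed.
Lemma sat_min P A B : saturated P B -> ideal_sub A B -> ideal_sub (sat P A) B.
Proof. by move=> hB h x [u hu /h]; exact: hB. Qed.

Lemma prime_pow P x n : is_prime_ideal P -> P (x ^+ n) -> P x.
Proof.
case=> _ P1 hM; elim: n => [|n IH]; first by rewrite expr0.
by rewrite exprS => /hM[].
Qed.
Lemma prime_prod P (T : finType) (F : T -> R) : is_prime_ideal P ->
  (forall i, ~ P (F i)) -> ~ P (\prod_i F i).
Proof.
by case=> _ P1 hM hF; apply: (big_ind (fun x => ~ P x)) => // x y hx hy /hM[].
Qed.

Lemma det_congr A n (M N : 'M[R]_n) : is_ideal A ->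
  (forall i j, A (M i j - N i j)) -> A (\det M - \det N).
Proof.
move=> hA h.
have hsum T (s : seq T) (F G : T -> R) : (forall i, A (F i - G i)) ->
    A (\sum_(i <- s) F i - \sum_(i <- s) G i).
  move=> hF; apply: (big_ind2 (fun x y => A (x - y))) => //.
    by rewrite subrr; exact: id0.
  by move=> x1 x2 y1 y2 h1 h2; rewrite opprD addrACA; apply: idD.
apply: hsum => s.
rewrite -mulrBr; apply: idMl => //.
apply: (big_ind2 (fun x y => A (x - y))) => //; first by rewrite subrr; exact: id0.
move=> x1 x2 y1 y2 h1 h2.
have -> : x1 * y1 - x2 * y2 = x1 * (y1 - y2) + y2 * (x1 - x2) by ring.
by apply: idD => //; apply: idMl.
Qed.

Lemma cramer A n (M : 'M[R]_n) (g : 'I_n -> R) : is_ideal A ->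
  (forall i, A (\sum_j M i j * g j)) -> forall i, A (\det M * g i).
Proof.
move=> hA h i; pose v := \col_j g j.
have -> : \det M * g i = (\adj M *m (M *m v)) i 0.
  by rewrite mulmxA mul_adj_mx mul_scalar_mx !mxE.
rewrite mxE; apply: id_sum => // j; apply: idMl => //; rewrite mxE.
by under eq_bigr do rewrite mxE; exact: h.
Qed.

(* Nakayama's lemma at a prime P, without localizing: the localization of
   (span s + K)/K at P is zero if it equals P times itself. *)
Lemma nakayama_prime P K s : is_prime_ideal P -> is_ideal K ->
  (forall g, span s g -> exists2 u, ~ P u & isum (ideal_mul P (span s)) K (u * g)) ->
  exists2 u, ~ P u & forall g, span s g -> K (u * g).
Proof.
move=> pP hK h; have [hP _ _] := pP; pose n := size s.
have /choice[f hf] (i : 'I_n) : exists ue : R * ('I_n -> R),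
    [/\ ~ P ue.1, forall j, P (ue.2 j) & K (ue.1 * s`_i - \sum_j ue.2 j * s`_j)].
  have [|u hu [_ [b [/(mul_span_comb hP)[e he ->] hb eq]]]] := h s`_i.
    by apply: span_in; apply: mem_nth.
  by exists (u, e); split=> //=; rewrite eq addrAC subrr add0r.
pose D : 'M[R]_n := diag_mx (\row_i (f i).1).
pose M := \matrix_(i, j) (D i j - (f i).2 j).
(* Modulo P the matrix [M] is the diagonal matrix [D], so its determinant lies outside P; modulo K
   it annihilates the column of generators. *)
exists (\det M).
  have hD : ~ P (\det D).
    rewrite det_diag; apply: prime_prod => // i; rewrite mxE.
    by have [] := hf i.
  move=> hM; apply: hD; rewrite -[\det D](subrK (\det M)); apply: idD => //.
  apply: det_congr => // i j; rewrite [M i j]mxE opprB addrC subrK.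
  by have [_ ] := hf i.
move=> g hg; rewrite mulrC.
apply: (span_min (colon_ideal _ hK) _ hg) => x hx.
have hi : (index x s < n)%N by rewrite index_mem.
rewrite /colon mulrC -(nth_index 0 hx).
apply: (@cramer K n M (fun j => s`_j) hK _ (Ordinal hi)) => i.
have [_ _] := hf i; congr (K _).
under [in RHS]eq_bigr => j _ do rewrite mxE mulrBl.
rewrite sumrB; congr (_ - _).
rewrite (bigD1 i) //= !mxE eqxx mulr1n big1 ?addr0 // => j ji.
by rewrite !mxE eq_sym (negbTE ji) mulr0n mul0r.
Qed.

(** * Noetherian induction and primes over an ideal *)

Hypothesis noeth : noetherian R.

Lemma ideal_span A : is_ideal A -> exists s, A = span s.
Proof. by move=> /noeth[s hs]; exists s; apply/predeqP. Qed.

(** A counterexample would start, by choice, a strictly ascending chain of ideals. The union is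
    finitely generated, so its generators lie in one stage, which then contains the next. *)
Lemma noetherian_ind (F : (R -> Prop) -> Prop) :
  (forall K, is_ideal K ->
     (forall K', is_ideal K' -> ideal_sub K K' -> ~ ideal_sub K' K -> F K') -> F K) ->
  forall K, is_ideal K -> F K.
Proof.
move=> H K0 hK0; apply: contrapT => nF.
have /choice[f hf] K : exists K', is_ideal K -> ~ F K ->
   [/\ is_ideal K', ideal_sub K K', ~ ideal_sub K' K & ~ F K'].
  have [[hK nFK]|nn] := pselect (is_ideal K /\ ~ F K); last first.
    by exists K => hK nFK; case: nn.
  apply: contrapT => /forallNP no; apply: nFK; apply: H => // K' hK' s1 s2.
  by apply: contrapT => nFK'; apply: (no K').
pose C n := iter n f K0.
have hC n : is_ideal (C n) /\ ~ F (C n).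
  by elim: n => [|n [h1 h2]] //=; have [] := hf _ h1 h2.
have hS n : ideal_sub (C n) (C n.+1) /\ ~ ideal_sub (C n.+1) (C n).
  by have [h1 h2] := hC n; have [] := hf _ h1 h2.
have mono a b : (a <= b)%N -> ideal_sub (C a) (C b).
  move=> /subnK <-; elim: (b - a)%N => [|k IH] //; rewrite addSn.
  by apply: sub_trans IH _; have [] := hS (k + a)%N.
pose U x := exists n, C n x.
have hU : is_ideal U.
  split; first by exists 0%N; exact: id0.
    move=> x y [a ha] [b hb]; exists (maxn a b); apply: idD.
    - by have [] := hC (maxn a b).
    - by apply: (mono a); rewrite ?leq_maxl.
    - by apply: (mono b); rewrite ?leq_maxr.
  by move=> r x [a ha]; exists a; apply: idMl => //; have [] := hC a.
have [s sU] := ideal_span hU.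
have [N hN] : exists N, forall x, x \in s -> C N x.
  have : forall x, x \in s -> U x by move=> x hx; rewrite sU; exact: span_in.
  elim: s {sU} => [|x s IH] hs; first by exists 0%N.
  have [|N hN] := IH; first by move=> y hy; apply: hs; rewrite inE hy orbT.
  have [M hM] := hs x (mem_head _ _); exists (maxn M N) => y.
  rewrite inE => /orP[/eqP ->|/hN]; [apply: (mono M) => // | apply: mono].
    exact: leq_maxl.
  exact: leq_maxr.
have [_ []] := hS N; move=> x hx.
have : U x by exists N.+1.
by rewrite sU; apply: span_min => //; have [] := hC N.
Qed.

Lemma noetherian_max (F : (R -> Prop) -> Prop) K :
  (forall A, F A -> is_ideal A) -> F K ->
  exists M, [/\ F M, ideal_sub K M &
                forall M', F M' -> ideal_sub M M' -> ideal_sub M' M].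
Proof.
move=> hF FK; have hK := hF _ FK; elim/noetherian_ind: K / hK FK => K hK IH FK.
have [[K' [FK' s1 s2]]|no] := pselect (exists K', [/\ F K', ideal_sub K K' & ~ ideal_sub K' K]).
  have [M [FM sM mx]] := IH _ (hF _ FK') s1 s2 FK'.
  by exists M; split=> //; apply: sub_trans sM.
exists K; split=> // M' FM' s1; apply: contrapT => s2.
by case: no; exists M'.
Qed.

(** An ideal maximal among those that miss the multiplicative set S is prime: adding a or b to it
    makes it meet S, and the product of the two elements found lies in it if ab does. *)
Lemma prime_avoiding (S : R -> Prop) K : is_ideal K -> S 1 ->
  (forall x y, S x -> S y -> S (x * y)) -> (forall x, K x -> ~ S x) ->
  exists Q, [/\ is_prime_ideal Q, ideal_sub K Q & forall x, Q x -> ~ S x].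
Proof.
move=> hK S1 SM dis.
pose F A := is_ideal A /\ forall x, A x -> ~ S x.
have [|//|Q [[hQ dQ] sQ mx]] := @noetherian_max F K; first by move=> A [].
exists Q; split=> //; split=> // [/dQ//|a b hab].
have add c : ~ Q c -> exists u r, Q u /\ S (u + r * c).
  move=> nc; apply: contrapT => no; apply: nc.
  have hs : is_ideal (isum Q (principal c)) by apply: isum_ideal => //; exact: principal_ideal.
  apply: (mx (isum Q (principal c))).
  - split=> // _ [u [_ [hu [r _ ->] ->]]] hS; apply: no.
    by exists u, r; rewrite mulrC.
  - exact/isuml/principal_ideal.
  - by apply: isumr => //; exact: principal_gen.
have [|na] := pselect (Q a); [by left | right]; apply: contrapT => nb.
have [u [r [hu hS]]] := add a na; have [v [t [hv hS']]] := add b nb.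
apply: (dQ _ _ (SM _ _ hS hS')).
have -> : (u + r * a) * (v + t * b) = (v + t * b) * u + (r * a) * v + (r * t) * (a * b) by ring.
by apply: idD; [ | apply: idD | ] => //; apply: idMl.
Qed.

(** Otherwise a prime over K misses all products u x^n with u outside P. It lies inside P (take n =
    0) and omits x, against minimality. *)
Lemma minimal_prime_nilp P K x : is_prime_ideal P -> is_ideal K ->
  (forall Q, is_prime_ideal Q -> ideal_sub K Q -> ideal_sub Q P -> ideal_sub P Q) ->
  P x -> exists n u, ~ P u /\ K (u * x ^+ n).
Proof.
move=> pP hK mn Px; apply: contrapT => no; have [hP P1 hM] := pP.
have [| | |Q [pQ KQ dQ]] :=
    @prime_avoiding (fun y => exists n u, ~ P u /\ y = u * x ^+ n) K hK.
- by exists 0%N, 1; rewrite expr0 mulr1.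
- move=> _ _ [n [u [hu ->]]] [k [v [hv ->]]]; exists (n + k)%N, (u * v); split; first by case/hM.
  by rewrite exprD mulrACA.
- by move=> y Ky [n [u [hu e]]]; apply: no; exists n, u; rewrite -e.
have QP : ideal_sub Q P.
  move=> y Qy; apply: contrapT => ny; apply: (dQ _ Qy).
  by exists 0%N, y; rewrite expr0 mulr1.
have Qx := mn _ pQ KQ QP _ Px.
by apply: (dQ _ Qx); exists 1%N, 1; rewrite expr1 mul1r.
Qed.

(** If ab is in K with a and b outside K, every prime over K contains K + (a) or K + (b), and
    Noetherian induction supplies a list for each. *)
Lemma primes_over_finite K : is_ideal K ->
  exists Ps : seq (R -> Prop), (forall P, List.In P Ps -> is_prime_ideal P) /\
    forall Q, is_prime_ideal Q -> ideal_sub K Q ->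
      exists P, [/\ List.In P Ps, ideal_sub K P & ideal_sub P Q].
Proof.
move=> hK; elim/noetherian_ind: K / hK => K hK IH.
have [pK|npK] := pselect (is_prime_ideal K).
  by exists [:: K]; split=> [P [<-|//]//|Q pQ KQ]; exists K; split=> //; left.
have [K1|K1] := pselect (K 1).
  by exists [::]; split=> // Q [_ Q1 _] KQ; case: Q1; exact: KQ.
have [a [b [hab na nb]]] : exists a b, [/\ K (a * b), ~ K a & ~ K b].
  apply: contrapT => no; apply: npK; split=> // a b hab.
  by apply: contrapT => /not_orP[? ?]; apply: no; exists a, b.
have step c : ~ K c -> exists Ps : seq (R -> Prop), (forall P, List.In P Ps -> is_prime_ideal P) /\
    forall Q, is_prime_ideal Q -> ideal_sub K Q -> Q c ->
      exists P, [/\ List.In P Ps, ideal_sub K P & ideal_sub P Q].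
  move=> nc; have s1 : ideal_sub K (isum K (principal c)) by exact/isuml/principal_ideal.
  have s2 : isum K (principal c) c by apply: isumr => //; exact: principal_gen.
  have [|Ps [h1 h2]] := IH _ (isum_ideal hK (principal_ideal c)) s1; first by move/(_ _ s2).
  exists Ps; split=> // Q pQ KQ Qc; have [hQ _ _] := pQ.
  have [|P [P1 P2 P3]] := h2 Q pQ.
    by apply: isum_min => //; exact: principal_min.
  by exists P; split=> //; apply: sub_trans P2.
have [Pa [a1 a2]] := step a na; have [Pb [b1 b2]] := step b nb.
exists (Pa ++ Pb); split=> [P /List.in_app_iff[]|Q pQ KQ]; [exact: a1|exact: b1|].
have [_ _ /(_ a b (KQ _ hab))[Qa|Qb]] := pQ.
  by have [P [? ? ?]] := a2 Q pQ KQ Qa; exists P; split=> //; apply/List.in_app_iff; left.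
by have [P [? ? ?]] := b2 Q pQ KQ Qb; exists P; split=> //; apply/List.in_app_iff; right.
Qed.

End Ideals.
Arguments whole {R}.

(** * Length of localizations and Krull's height theorem *)

Section Chains.
Variables (R : comNzRingType).
Implicit Types (A B C D K I P : R -> Prop) (x y g : R) (s : seq R) (c : nat).

(* [chain P B A c] says that the localization at P of the module A/B has length
   at least c; P-saturated ideals stand for the ideals of the local ring R_P.
   The strict inclusions are B <= A_0 < A_1 < ... < A_c = A. *)
Fixpoint chain P B A c : Prop :=
  match c with
  | 0%N => ideal_sub B A
  | c'.+1 => exists A', [/\ is_ideal A', saturated P A', ideal_sub A' A,
                            ~ ideal_sub A A' & chain P B A' c']
  end.

Lemma chain_sub P B A c : chain P B A c -> ideal_sub B A.
Proof.
by elim: c A => [|c IH] A //= [A' [_ _ s1 _ /IH s2]]; apply: sub_trans s1.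
Qed.
Lemma chain_mono P B A A' c : ideal_sub A A' -> chain P B A c -> chain P B A' c.
Proof.
case: c => [|c] s1 /=; first by move=> s2; apply: sub_trans s1.
move=> [C [hC sC s2 ns ch]]; exists C; split=> //; first exact: sub_trans s1.
by move=> s3; apply: ns; exact: sub_trans s3.
Qed.
Lemma chain_anti P B B' A c : ideal_sub B' B -> chain P B A c -> chain P B' A c.
Proof.
move=> s1; elim: c A => [|c IH] A /=; first exact: sub_trans.
by move=> [C [hC sC s2 ns /IH ch]]; exists C.
Qed.
Lemma chain_trunc P B A c c' : (c' <= c)%N -> chain P B A c -> chain P B A c'.
Proof.
move=> /subnK <-; elim: (c - c')%N => [|k IH] //; rewrite addSn => -[C [_ _ s1 _ h]].
by apply: IH; apply: chain_mono h.
Qed.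
Lemma chain_cat P B C A a b : chain P B C a -> chain P C A b -> chain P B A (a + b).
Proof.
move=> h; elim: b A => [|b IH] A; first by rewrite addn0 => s; apply: chain_mono h.
by rewrite addnS => -[A' [hA sA s1 ns /IH ch]]; exists A'.
Qed.
Lemma chain_sat P B A c : saturated P A -> chain P B A c -> chain P (sat P B) A c.
Proof.
elim: c A => [|c IH] A sA /=; first exact: sat_min.
by move=> [A' [hA' sA' s1 ns ch]]; exists A'; split=> //; apply: IH.
Qed.

Lemma icap_saturated P A B : saturated P A -> saturated P B -> saturated P (icap A B).
Proof. by move=> hA hB u x hu [h1 h2]; split; [exact: hA h1 | exact: hB h2]. Qed.
Lemma colon_saturated P A g : saturated P A -> saturated P (colon A g).
Proof. by move=> hA u x hu; rewrite /colon -mulrA; exact: hA. Qed.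
Lemma whole_saturated P : saturated P whole. Proof. by []. Qed.

(* The modular law: each step of a chain stays strict after intersecting with D
   or after adding D. *)
Lemma chain_split P B D A c : is_prime_ideal P ->
  is_ideal D -> saturated P D -> ideal_sub B D ->
  is_ideal A -> saturated P A -> chain P B A c ->
  exists a b, [/\ (a + b)%N = c, chain P B (icap A D) a & chain P D (sat P (isum A D)) b].
Proof.
move=> pP hD sD BD; elim: c A => [|c IH] A hA sA.
  move=> BA; exists 0%N, 0%N; split=> //=; first by move=> x hx; split; [exact: BA | exact: BD].
  by apply: sub_trans (sat_sub pP); apply: isumr.
move=> [A' [hA' sA' s1 ns /(IH _ hA' sA')[a [b [eab c1 c2]]]]].
have [s|nss] := pselect (ideal_sub (icap A D) (icap A' D)); last first.
  exists a.+1, b; split; first by rewrite addSn eab.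
    exists (icap A' D); split=> //; [exact: icap_ideal | exact: icap_saturated|].
    by move=> x [/s1].
  apply: chain_mono c2; apply: sat_min; first exact: sat_saturated.
  by apply: sub_trans (sat_sub pP); apply: isum_mono.
exists a, b.+1; split; first by rewrite addnS eab.
  by apply: chain_mono c1 => x [/s1].
exists (sat P (isum A' D)); split=> //.
- by apply: sat_ideal => //; apply: isum_ideal.
- exact: sat_saturated.
- apply: sat_min; first exact: sat_saturated.
  by apply: sub_trans (sat_sub pP); apply: isum_mono.
move=> h; apply: ns => y Ay.
have [|u hu [y' [e [hy' he eq]]]] := h y.
  by apply: sat_sub => //; apply: isuml.
apply: (sA' u) => //.
have [] : icap A' D e; last by move=> he' _; rewrite eq; apply: idD.
apply: s; split=> //; have -> : e = u * y - y' by rewrite eq addrAC subrr add0r.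
by apply: idB => //; [apply: idMl | exact: s1].
Qed.

(** Multiplication by g maps R/(B : g) isomorphically onto (B + gR)/B, and A/B sits inside the
    latter after localization. *)
Lemma chain_colon P B A g c : is_prime_ideal P ->
  is_ideal A -> ideal_sub A (sat P (isum B (principal g))) -> chain P B A c ->
  chain P (colon B g) (colon A g) c.
Proof.
move=> pP; elim: c A => [|c IH] A hA sg; first by move=> BA x; apply: BA.
move=> [A' [hA' sA' s1 /not_sub[y Ay nA'y] ch]].
have BA' := chain_sub ch.
exists (colon A' g); split.
- exact: colon_ideal.
- exact: colon_saturated.
- by move=> x; apply: s1.
- have [u hu [b [_ [hb [r _ ->] eq]]]] := sg _ Ay.
  move=> h; apply: nA'y; apply: (sA' u) => //; rewrite eq.
  apply: idD => //; first exact: BA'.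
  rewrite mulrC; apply: h; rewrite /colon mulrC.
  have -> : g * r = u * y - b by rewrite eq addrAC subrr add0r.
  by apply: idB => //; [apply: idMl | apply/s1/BA'].
by apply: IH => //; apply: sub_trans sg.
Qed.

Lemma chain_prime_whole P : is_prime_ideal P -> ~ chain P P whole 2.
Proof.
move=> [hP P1 hM] [A' [hA' sA' _ ns [A'' [_ _ s2 /not_sub[y Ay nAy] PA]]]].
apply: ns; apply: ideal_one_whole => //; apply: (sA' y); last by rewrite mulr1.
by move=> /PA.
Qed.

Lemma chain_saturated_eq P B A : ideal_sub A B -> is_ideal B -> ~ chain P B A 1.
Proof. by move=> AB hB [A' [_ _ _ ns BA']]; apply: ns; exact: sub_trans BA'. Qed.

Lemma chain_cyclic P B D g c : is_prime_ideal P -> is_ideal D ->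
  ideal_sub D (sat P (isum B (principal g))) -> ideal_sub (imul_elt g P) B ->
  chain P B D c -> (c <= 1)%N.
Proof.
move=> pP hD Dg gP /(chain_colon pP hD Dg) ch; rewrite leqNgt; apply/negP => hc.
apply: (chain_prime_whole pP); apply: chain_trunc hc _.
apply: chain_mono (chain_anti _ ch) => // x Px.
by apply: gP; exists x => //; rewrite mulrC.
Qed.

Lemma finite_length P K : noetherian R -> is_prime_ideal P -> is_ideal K ->
  (forall x, P x -> exists n u, ~ P u /\ K (u * x ^+ n)) ->
  exists c, ~ chain P K whole c.
Proof.
move=> noeth pP hK; have [hP P1 hM] := pP.
elim/(noetherian_ind noeth): K / hK => K hK IH nil.
have hsK : is_ideal (sat P K) by apply: sat_ideal.
have [s1|ns1] := pselect (sat P K 1).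
  exists 1%N => -[A [hA sA _ ns KA]]; apply: ns; apply: ideal_one_whole => //.
  exact: sat_min KA _ s1.
have [s sP] := ideal_span noeth hP.
have [g [ng hg]] : exists g, ~ sat P K g /\ forall p, p \in s -> sat P K (p * g).
  have : forall p, p \in s -> P p by move=> p hp; rewrite sP; exact: span_in.
  elim: s {sP} => [|p s IHs] hs; first by exists 1.
  have [|g [ng hg]] := IHs; first by move=> q hq; apply: hs; rewrite inE hq orbT.
  (* Multiplying g by the last power of p that keeps it outside [sat P K] makes p kill it; the
     generators treated before still do. *)
  have ex : exists n, sat P K (p ^+ n * g).
    have [n [u [hu hk]]] := nil p (hs _ (mem_head _ _)).
    by exists n; apply: idMr => //; exists u.
  have ex' : exists n, `[< sat P K (p ^+ n * g) >] by case: ex => n hn; exists n; exact/asboolP.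
  case: (ex_minnP ex') => -[|n] /asboolP hn mn; first by case: ng; rewrite expr0 mul1r in hn.
  exists (p ^+ n * g); split.
    by move=> /asboolP /mn; rewrite ltnn.
  move=> q; rewrite inE => /orP[/eqP ->|/hg hq]; first by rewrite mulrA -exprS.
  by rewrite mulrCA; apply: idMl.
have K1 : ideal_sub K (isum K (principal g)) by exact/isuml/principal_ideal.
have K2 : isum K (principal g) g by apply: isumr => //; exact: principal_gen.
have hK' := isum_ideal hK (principal_ideal g).
have [||c' nc] := IH _ hK' K1.
- by move/(_ _ K2) => Kg; apply: ng; exact: sat_sub.
- by move=> x /nil[n [u [hu h]]]; exists n, u; split=> //; apply: K1.
exists c'.+1 => ch; pose D := sat P (isum K (principal g)).
have hD : is_ideal D by apply: sat_ideal.
have sD : saturated P D by apply: sat_saturated.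
have KD : ideal_sub K D by apply: sub_trans (sat_sub pP).
have [a [b [eab c1 c2]]] := chain_split pP hD sD KD (whole_ideal _) (@whole_saturated P) ch.
have ha : (a <= 1)%N.
  have c3 : chain P (sat P K) D a by apply: chain_sat => //; apply: chain_mono c1 => x [].
  apply: (chain_cyclic (g := g) pP hD _ _ c3) => [|_ [p hp ->]].
    apply: sat_min; first exact: sat_saturated.
    apply: sub_trans (sat_sub pP); apply: isum_mono => //; exact: sat_sub.
  rewrite mulrC; rewrite sP in hp; exact: (span_min (colon_ideal g hsK) _ hp).
apply: nc; apply: (chain_trunc (c := b)); first by rewrite -ltnS -eab -add1n leq_add2r.
apply: chain_mono (chain_anti _ c2) => //; exact: sub_trans (sat_sub pP).
Qed.

(* Krull's principal ideal theorem in the domain R/Q0, through the symbolic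
   powers S n of Q: the finite length of R_P/(x) makes them stabilize modulo x,
   hence stabilize, which forces Q^n = 0 in R_Q. *)
Lemma principal_ideal_theorem Q0 Q P x : noetherian R ->
  is_prime_ideal Q0 -> is_prime_ideal Q -> is_prime_ideal P ->
  ideal_sub Q0 Q -> ~ ideal_sub Q Q0 -> ideal_sub Q P -> ~ ideal_sub P Q -> P x ->
  ~ (forall P', is_prime_ideal P' -> ideal_sub Q0 P' -> P' x -> ideal_sub P' P ->
       ideal_sub P P').
Proof.
move=> noeth pQ0 pQ pP s0 ns0 s1 ns1 Px mn.
have [hQ0 Q01 Q0M] := pQ0; have [hQ Q1 QM] := pQ; have [hP P1 PM] := pP.
have nQx : ~ Q x by move=> Qx; apply: ns1; exact: mn.
have nPQ u : ~ P u -> ~ Q u by move=> h /s1.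
pose S n := sat Q (isum (ideal_pow Q n) Q0).
have hS n : is_ideal (S n) by apply: sat_ideal => //; apply: isum_ideal => //; exact: pow_ideal.
have sS n : saturated Q (S n) by apply: sat_saturated.
have S0 n : ideal_sub Q0 (S n) by apply: sub_trans (sat_sub pQ); apply: isumr; exact: pow_ideal.
have Spow n : ideal_sub (ideal_pow Q n) (S n) by apply: sub_trans (sat_sub pQ); exact: isuml.
have Smono n : ideal_sub (S n.+1) (S n).
  apply: sat_min => //; apply: isum_min => //; apply: sub_trans (Spow n); exact: powS_sub.
pose K := isum Q0 (principal x).
have hK : is_ideal K by apply: isum_ideal => //; exact: principal_ideal.
have Kx : K x by apply: isumr => //; exact: principal_gen.
have K0 : ideal_sub Q0 K by apply: isuml; exact: principal_ideal.
have [|c nc] := finite_length noeth pP hK.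
  move=> y; apply: (minimal_prime_nilp noeth pP hK) => P' pP' KP' P'P.
  by apply: mn => //; [exact: sub_trans KP' | exact: KP'].
pose D n := sat P (isum (S n) (principal x)).
have hsum n : is_ideal (isum (S n) (principal x)).
  by apply: isum_ideal => //; exact: principal_ideal.
have hD n : is_ideal (D n) by apply: sat_ideal.
(* If this failed for every n, the [D n] would descend strictly forever above K, against the finite
   length c. *)
have [n hn] : exists n, ideal_sub (S n) (D n.+1).
  apply: contrapT => /forallNP no; apply: nc.
  suff: forall k n, chain P K (D n) k by move=> /(_ c 0%N); apply: chain_mono.
  elim=> [|k IH] n /=.
    by apply: sub_trans (sat_sub pP); apply: isum_mono.
  exists (D n.+1); split=> //; first exact: sat_saturated.
    apply: sat_min; first exact: sat_saturated.
    by apply: sub_trans (sat_sub pP); apply: isum_mono.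
  move=> h; apply: (no n); apply: sub_trans h; apply: sub_trans (sat_sub pP).
  by apply: isuml; exact: principal_ideal.
(* An element x r of S n has r in S n, since x is outside Q. So S n lies in S (n + 1) + x S n
   locally at P, and Nakayama applies. *)
have [s es] := ideal_span noeth (hS n).
have hSn : ideal_sub (S n) (S n.+1).
  have [|u hu h] := @nakayama_prime R P (S n.+1) s pP (hS _).
    move=> g; rewrite -es => hg; have [u hu [b [_ [hb [r _ ->] eq]]]] := hn _ hg.
    exists u => //; rewrite eq addrC; exists (x * r), b; split=> //; apply: mul_in => //.
    apply: (sS n x) => //; have -> : x * r = u * g - b by rewrite eq addrAC subrr add0r.
    by apply: idB => //; [exact: idMl | exact: Smono].
  by move=> g; rewrite es => /h; apply: sS; exact: nPQ.
(* Now Q^n lies in Q Q^n + Q0 locally at Q. Nakayama at Q puts a multiple u Q^n into Q0 with u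
   outside Q, so the prime Q0 contains Q. *)
have [t et] := ideal_span noeth (pow_ideal Q n).
have [|u hu h] := @nakayama_prime R Q Q0 t pQ hQ0.
  move=> g; rewrite -et => hg; have [u hu h] := hSn _ (Spow n _ hg).
  by exists u.
apply: ns0 => q Qq; apply: (@prime_pow _ _ _ n pQ0).
have [|Qu|//] := Q0M u (q ^+ n); last by case: hu; apply: s0.
by apply: h; rewrite -et; exact: pow_in.
Qed.

(** * Heights of primes *)

Fixpoint height_ge P n : Prop :=
  match n with
  | 0%N => is_prime_ideal P
  | n'.+1 => is_prime_ideal P /\
      exists P', [/\ ideal_sub P' P, ~ ideal_sub P P' & height_ge P' n']
  end.

Lemma height_prime P n : height_ge P n -> is_prime_ideal P.
Proof. by case: n => [|n] //= []. Qed.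
Lemma height_mono P Q n : is_prime_ideal Q -> ideal_sub P Q -> height_ge P n -> height_ge Q n.
Proof.
case: n => [|n] // pQ s [pP [P' [s1 ns h]]]; split=> //; exists P'; split=> //.
  exact: sub_trans s.
by move=> s'; apply: ns; exact: sub_trans s'.
Qed.
Lemma height_trunc P n n' : (n' <= n)%N -> height_ge P n -> height_ge P n'.
Proof.
move=> /subnK <-; elim: (n - n')%N => [|k IH] //; rewrite addSn => -[pP [P' [s ns h]]].
by apply: IH; apply: height_mono h.
Qed.
Lemma chain_height (C : nat -> R -> Prop) n : prime_chain C n -> height_ge (C n) n.
Proof.
elim: n => [|n IH] [h1 h2]; first exact: h1.
split; first exact: h1.
have [s ns] := h2 n (leqnn _); exists (C n); split=> //.
by apply: IH; split=> i hi; [apply: h1 | apply: h2]; exact: leqW.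
Qed.
Lemma height_chain P n : height_ge P n -> exists C : nat -> R -> Prop, prime_chain C n /\ C n = P.
Proof.
elim: n P => [|n IH] P; first by move=> pP; exists (fun=> P).
move=> [pP [P' [s ns /IH[C [[h1 h2] e]]]]].
exists (fun i => if (i <= n)%N then C i else P); rewrite ltnn; split=> //; split=> i hi.
  by case: ifP => // h; apply: h1.
rewrite -ltnS hi; case: ifP => h; first exact: h2.
have -> : i = n by apply/eqP; rewrite eqn_leq -ltnS hi leqNgt h.
by rewrite e.
Qed.

(** Induction on the number of generators. M is maximal among the primes strictly inside P that
    contain Q, and y in s is outside M. Then P is minimal over M + (y), so each w in s satisfies u
    w^k = v + y r with u outside P and v in M. M is minimal over these v for w other than y: a
    smaller prime Q' over them would make P minimal over Q' + (y), with M strictly between. So the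
    induction hypothesis bounds the height of M. *)
Lemma height_theorem P s : noetherian R -> is_prime_ideal P ->
  (forall Q, is_prime_ideal Q -> (forall w, w \in s -> Q w) -> ideal_sub Q P -> ideal_sub P Q) ->
  (forall w, w \in s -> P w) -> ~ height_ge P (size s).+1.
Proof.
move=> noeth; move en : (size s) => n.
elim: n s P en => [|n IH] s P en pP mn sP [_ [Q [QP nQP hQ]]].
  by apply: nQP; apply: mn => //= w; rewrite (size0nil en).
pose F Q' := [/\ is_prime_ideal Q', ideal_sub Q' P & ~ ideal_sub P Q'].
have FQ : F Q by split=> //; exact: (@height_prime Q n.+1 hQ).
have [M [[pM MP nMP] QM mx]] : exists M, [/\ F M, ideal_sub Q M &
    forall M', F M' -> ideal_sub M M' -> ideal_sub M' M].
  by apply: noetherian_max => // A [[]].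
have hM : height_ge M n.+1 := height_mono (n := n.+1) pM QM hQ.
have [y hy nMy] : exists2 y, y \in s & ~ M y.
  apply: contrapT => no; apply: nMP; apply: mn => // w hw.
  by apply: contrapT => nw; apply: no; exists w.
have [hP P1 PM] := pP; have [hMi M1 MM] := pM.
have hK := isum_ideal hMi (principal_ideal y).
have K0 : ideal_sub M (isum M (principal y)) by apply: isuml; exact: principal_ideal.
have Ky : isum M (principal y) y by apply: isumr => //; exact: principal_gen.
have mnK Q' : is_prime_ideal Q' -> ideal_sub (isum M (principal y)) Q' -> ideal_sub Q' P ->
    ideal_sub P Q'.
  move=> pQ' KQ' Q'P; apply: contrapT => ns; apply: nMy; apply: (mx Q') => //.
    exact: sub_trans KQ'.
  exact: KQ'.
have /choice[v hv] w : exists v, w \in s -> M v /\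
    forall Q', is_prime_ideal Q' -> ideal_sub Q' P -> Q' v -> Q' y -> Q' w.
  have [hw|nw] := pselect (w \in s); last by exists 0.
  have [k [u [hu [v [_ [hv [r _ ->] eq]]]]]] := minimal_prime_nilp noeth pP hK mnK (sP _ hw).
  exists v => _; split=> // Q' pQ' Q'P Q'v Q'y; have [hQ' _ Q'M] := pQ'.
  have [|/Q'P//|] := Q'M u (w ^+ k); last exact: prime_pow.
  by rewrite eq; apply: idD => //; apply: idMr.
apply: (IH [seq v w | w <- rem y s] M) => //.
- by rewrite size_map size_rem // en.
- move=> Q' pQ' vQ' Q'M; apply: contrapT => nMQ'.
  apply: (@principal_ideal_theorem Q' M P y) => //; first exact: sP.
  move=> P' pP' Q'P' P'y P'P; apply: mn => // w hw.
  have [->//|nwy] := eqVneq w y.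
  have [_] := hv w hw; apply=> //; apply: Q'P'; apply: vQ'; apply: map_f.
  by rewrite rem_mem.
- move=> _ /mapP[w /mem_rem hw ->]; by have [] := hv w hw.
Qed.

End Chains.

(** * Length over a local ring *)

Lemma List_In_map (T : eqType) (T' : Type) (f : T -> T') (s : seq T) u :
  List.In u [seq f x | x <- s] -> exists2 x, x \in s & u = f x.
Proof.
elim: s => //= x s IH [<-|/IH[y hy ->]]; first by exists x => //; exact: mem_head.
by exists y => //; rewrite inE hy orbT.
Qed.
Lemma List_map_In (T : eqType) (T' : Type) (f : T -> T') (s : seq T) x :
  x \in s -> List.In (f x) [seq f x | x <- s].
Proof. by elim: s => //= y s IH; rewrite inE => /orP[/eqP ->|/IH]; [left | right]. Qed.

Lemma lift_seq (T U : eqType) (f : U -> T) (Q : U -> Prop) (s : seq T) :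
  (forall x, x \in s -> exists2 p, Q p & x = f p) ->
  exists2 ps, s = map f ps & forall p, p \in ps -> Q p.
Proof.
elim: s => [|x s IH] h; first by exists [::].
have [|ps -> hp] := IH; first by move=> y hy; apply: h; rewrite inE hy orbT.
have [p Qp ->] := h x (mem_head _ _); exists (p :: ps) => // q.
by rewrite inE => /orP[/eqP ->|/hp].
Qed.

Section Local.
Variables (R : comNzRingType) (m : R -> Prop).
Hypotheses (noeth : noetherian R) (loc : local_with_max m).
Implicit Types (A B D K I N : R -> Prop) (x y t : R) (s xs : seq R) (c k l : nat).

Lemma nonmax_unit u : ~ m u -> exists v, v * u = 1.
Proof.
move=> nu; have [_ _ mx] := loc; apply: contrapT => no; apply: nu.
apply: (mx _ (principal_ideal u)); last exact: principal_gen.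
by move=> [r _ e]; apply: no; exists r; rewrite mulrC.
Qed.
Lemma max_prime : is_prime_ideal m.
Proof.
have [hm m1 mx] := loc; split=> // a b hab; have [|na] := pselect (m a); [by left | right].
have [v e] := nonmax_unit na.
by rewrite -[b]mul1r -e -mulrA; apply: idMl.
Qed.
Lemma max_unique P : is_prime_ideal P -> ideal_sub P m.
Proof. by move=> [hP P1 _]; have [_ _ mx] := loc; exact: mx. Qed.
Lemma local_saturated A : is_ideal A -> saturated m A.
Proof.
move=> hA u x nu hx; have [v e] := nonmax_unit nu.
by rewrite -[x]mul1r -e -mulrA; apply: idMl.
Qed.
Lemma nakayama G K : is_ideal G -> is_ideal K ->
  ideal_sub G (isum (ideal_mul m G) K) -> ideal_sub G K.
Proof.
move=> hG hK h; have [s eG] := ideal_span noeth hG; subst G.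
have [|u nu hu] := @nakayama_prime R m K s max_prime hK.
  by move=> g hg; exists 1; [have [] := max_prime | rewrite mul1r; exact: h].
by move=> g /hu; exact: local_saturated.
Qed.

(** Over the local ring every ideal is saturated for m, so [~ chain m B A c.+1] says that A/B itself
    has length at most c. *)
Lemma length_add B D A (a b : nat) : is_ideal D -> is_ideal A ->
  ideal_sub B D -> ideal_sub D A ->
  ~ chain m B D a.+1 -> ~ chain m D A b.+1 -> ~ chain m B A (a + b).+1.
Proof.
move=> hD hA BD DA na nb ch.
have [a' [b' [e c1 c2]]] := chain_split max_prime hD (local_saturated hD) BD hA
  (local_saturated hA) ch.
have [ha|ha] := leqP a' a; last first.
  by apply: na; apply: chain_trunc ha _; apply: chain_mono c1 => x [].
apply: nb; apply: (chain_trunc (c := b')).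
  by rewrite -(leq_add2l a) addnS -e leq_add2r.
apply: chain_mono c2; apply: sat_min; first exact: local_saturated.
exact: isum_min.
Qed.

Lemma chain_extend B x A c : is_ideal B -> ~ B x ->
  chain m (isum B (principal x)) A c -> chain m B A c.+1.
Proof.
move=> hB nB ch; rewrite -add1n; apply: chain_cat ch; exists B; split=> //.
- exact: local_saturated.
- by apply: isuml; exact: principal_ideal.
- by move=> h; apply: nB; apply: h; apply: isumr => //; exact: principal_gen.
Qed.

(** Each element of T outside the ideal reached so far lengthens a chain over B. T is not assumed to
    be an ideal, so the generators can be taken of a prescribed shape. *)
Lemma greedy_generators B A (T : R -> Prop) c : is_ideal B -> is_ideal A ->
  ideal_sub B A -> ideal_sub T A -> ~ chain m B A c ->
  exists s, [/\ forall x, x \in s -> T x, (size s < c)%N &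
                forall x, T x -> isum (span s) B x].
Proof.
move=> hB hA BA TA; elim: c B hB BA => [|c IH] B hB BA nch; first by case: nch.
have [TB|/not_sub[x Tx nBx]] := pselect (ideal_sub T B).
  by exists [::]; split=> // x /TB; apply: isumr; exact: span_ideal.
have hB' := isum_ideal hB (principal_ideal x).
have [||s [s1 s2 s3]] := IH _ hB'.
- by apply: isum_min => //; apply: principal_min => //; exact: TA.
- by move=> ch; apply: nch; exact: chain_extend ch.
exists (x :: s); split=> //.
  by move=> y; rewrite inE => /orP[/eqP ->|/s1].
have hS := isum_ideal (span_ideal (x :: s)) hB.
move=> y /s3; apply: isum_min => //.
  apply: span_min => // z hz; apply: isuml => //; apply: span_in.
  by rewrite inE hz orbT.
apply: isum_min => //; first by apply: isumr; exact: span_ideal.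
by apply: principal_min => //; apply: isuml => //; apply: span_in; exact: mem_head.
Qed.

Lemma length_span B s : is_ideal B ->
  (forall x, x \in s -> ideal_sub (imul_elt x m) B) ->
  ~ chain m B (isum B (span s)) (size s).+1.
Proof.
move=> hB; elim: s => [|x s IH] hs.
  apply: chain_saturated_eq => //; apply: isum_min => //.
  by apply: span_min.
have h1 := isum_ideal hB (span_ideal s).
have h2 := isum_ideal hB (span_ideal (x :: s)).
rewrite [size _]/= -[(size s).+1]addn1; apply: (length_add h1 h2).
- by apply: isuml; exact: span_ideal.
- apply: isum_mono => //; apply: span_min; first exact: span_ideal.
  by move=> y hy; apply: span_in; rewrite inE hy orbT.
- by apply: IH => y hy; apply: hs; rewrite inE hy orbT.
move=> ch; suff: (2 <= 1)%N by [].
apply: (chain_cyclic (g := x) max_prime h2 _ _ ch).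
  apply: sub_trans (sat_sub max_prime).
  have h3 := isum_ideal h1 (principal_ideal x).
  apply: isum_min => //.
    apply: sub_trans (isuml (span_ideal s)) _; apply: isuml; exact: principal_ideal.
  apply: sub_trans (@span_cons _ _ _) _; apply: isum_min => //; first exact: isumr.
  apply: sub_trans (isumr hB) _; apply: isuml; exact: principal_ideal.
by apply: sub_trans (isuml (span_ideal s)); apply: hs; exact: mem_head.
Qed.

(** * Powers of a finitely generated ideal *)

Lemma power_cons x xs n :
  ideal_sub (ideal_pow (span (x :: xs)) n.+1)
    (isum (ideal_pow (span xs) n.+1) (imul_elt x (ideal_pow (span (x :: xs)) n))).
Proof.
elim: n => [|n IH].
  have hI : is_ideal (isum (ideal_pow (span xs) 1) (principal x)).
    by apply: isum_ideal; [exact: pow_ideal | exact: principal_ideal].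
  apply: sub_trans (mul_subl (span_ideal _)) _.
  apply: sub_trans (@span_cons _ _ _) _; apply: isum_min => //.
    exact/isumr/pow_ideal.
  move=> y hy; apply: isuml; first exact: principal_ideal.
  by rewrite -[y]mulr1; apply: mul_in.
have hI : is_ideal (isum (ideal_pow (span xs) n.+2) (imul_elt x (ideal_pow (span (x :: xs)) n.+1))).
  by apply: isum_ideal; [exact: pow_ideal | apply: imul_elt_ideal; exact: pow_ideal].
apply: mul_min => // _ v /span_cons[_ [q [[r _ ->] hq ->]]] hv.
rewrite mulrDl; apply: idD => //.
  apply: isumr; first exact: pow_ideal.
  by exists (r * v); [exact: (idMl r (pow_ideal _ n.+1) hv) | rewrite mulrA].
have [v1 [_ [h1 [v2 h2 ->] ->]]] := IH _ hv.
exists (q * v1), (q * (x * v2)); split; [exact: mul_in| |by rewrite mulrDr].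
exists (q * v2); last by rewrite mulrCA.
apply: mul_in => //; apply: span_min hq => [|z hz]; first exact: span_ideal.
by apply: span_in; rewrite inE hz orbT.
Qed.

(** The binomial counts the monomials of degree n + 1: those without x, and x times those of degree
    n, as in Pascal's rule. *)
Lemma power_generators xs n : exists s, [/\ size s = 'C(n + size xs, n.+1),
  forall z, z \in s -> ideal_pow (span xs) n.+1 z &
  ideal_sub (ideal_pow (span xs) n.+1) (span s)].
Proof.
elim: xs n => [|x xs IH] n.
  by exists [::]; rewrite addn0 bin_small //; split=> //; apply: powS_subl; exact: span_ideal.
have sub k : ideal_sub (ideal_pow (span xs) k) (ideal_pow (span (x :: xs)) k).
  apply: pow_mono; apply: span_min; first exact: span_ideal.
  by move=> z hz; apply: span_in; rewrite inE hz orbT.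
elim: n => [|n [s2 [sz2 in2 sub2]]].
  exists (x :: xs); rewrite add0n bin1; split=> //; last by apply: powS_subl; exact: span_ideal.
  by move=> z hz; rewrite -[z]mulr1; apply: mul_in => //; exact: span_in.
have [s1 [sz1 in1 sub1]] := IH n.+1.
exists (s1 ++ [seq x * z | z <- s2]); split.
- by rewrite size_cat size_map sz1 sz2 [size (x :: xs)]/= !addnS binS !addSn.
- move=> z; rewrite mem_cat => /orP[/in1 hz|/mapP[w /in2 hw ->]]; first exact: sub.
  by apply: mul_in => //; apply: span_in; exact: mem_head.
apply: sub_trans (@power_cons _ _ _) _; apply: isum_min; first exact: span_ideal.
  apply: sub_trans sub1 _; apply: span_min; first exact: span_ideal.
  by move=> z hz; apply: span_in; rewrite mem_cat hz.
move=> _ [v /sub2 hv ->]; rewrite mulrC.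
apply: (span_min (colon_ideal x (span_ideal _)) _ hv) => z hz.
by rewrite /colon mulrC; apply: span_in; rewrite mem_cat map_f ?orbT.
Qed.

(** The growth is that of a polynomial ring over R/(K + (xs)). Multiplication by x splits the
    quotient along Pascal's rule: modulo x one generator fewer remains, with x absorbed into K, and
    the image of x is a quotient of the case of the smaller exponent. *)
Lemma length_power xs n l K : is_ideal K -> ~ chain m (isum K (span xs)) whole l.+1 ->
  ~ chain m (isum K (ideal_pow (span xs) n.+1)) whole (l * 'C(n + size xs, size xs)).+1.
Proof.
elim: xs n K => [|x xs IH] n K hK nl.
  rewrite bin0 muln1 => ch; apply: nl; apply: chain_anti ch.
  apply: isum_mono => //; apply: span_min => //; exact: pow_ideal.
elim: n => [|n IHn].
  rewrite binn muln1 => ch; apply: nl; apply: chain_anti ch; apply: isum_mono => // y hy.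
  by rewrite -[y]mulr1; apply: mul_in.
pose E := isum (ideal_pow (span xs) n.+2) (imul_elt x (ideal_pow (span (x :: xs)) n.+1)).
have hE : is_ideal E.
  by apply: isum_ideal; [exact: pow_ideal | apply: imul_elt_ideal; exact: pow_ideal].
have hD := isum_ideal hK hE.
have hD' := isum_ideal hD (principal_ideal x).
have DD' : ideal_sub (isum K E) (isum (isum K E) (principal x)).
  by apply: isuml; exact: principal_ideal.
have ED : ideal_sub E (isum K E) by exact: isumr.
have KD : ideal_sub K (isum K E) by exact: isuml.
have hs : ideal_sub (span xs) (span (x :: xs)).
  apply: span_min; first exact: span_ideal.
  by move=> z hz; apply: span_in; rewrite inE hz orbT.
move=> ch.
have {ch} : chain m (isum K E) whole (l * 'C(n.+1 + size (x :: xs), size (x :: xs))).+1.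
  apply: chain_anti ch; apply: isum_mono => //; apply: isum_min; first exact: pow_ideal.
    exact: pow_mono.
  by move=> _ [v hv ->]; apply: mul_in => //; apply: span_in; exact: mem_head.
rewrite [size _]/= addnS binS mulnDr.
apply: (length_add hD' (whole_ideal _)) => //.
  move=> ch; apply: IHn.
  have h : ideal_sub (isum (isum K E) (principal x))
     (sat m (isum (isum K E) (principal x))) := sat_sub max_prime.
  rewrite [size (x :: xs)]/= addnS -addSn.
  apply: chain_mono (chain_anti _ (chain_colon max_prime hD' h ch)) => //.
  apply: isum_min; first exact: colon_ideal.
    by move=> y hy; apply: KD; exact: idMr.
  move=> y hy; apply: ED; apply: isumr; first exact: pow_ideal.
  by exists y => //; rewrite mulrC.
have hK' := isum_ideal hK (principal_ideal x).
move=> ch; apply: (IH n.+1 _ hK'); last first.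
  apply: chain_anti ch; apply: isum_min => //.
    apply: isum_min => //; first exact: sub_trans DD'.
    exact: isumr.
  apply: sub_trans DD'; apply: sub_trans ED; apply: isuml.
  by apply: imul_elt_ideal; exact: pow_ideal.
move=> ch'; apply: nl; apply: chain_anti ch'.
have h3 := isum_ideal hK' (span_ideal xs).
apply: isum_min => //.
  apply: sub_trans (isuml (principal_ideal x)) _; apply: isuml; exact: span_ideal.
apply: sub_trans (@span_cons _ _ _) _; apply: isum_min => //; last exact: isumr.
apply: sub_trans (isumr hK) _; apply: isuml; exact: span_ideal.
Qed.

Lemma exact_length B A c : ideal_sub B A -> ~ chain m B A c ->
  exists2 k, chain m B A k & ~ chain m B A k.+1.
Proof.
move=> BA; elim: c => [|c IH] nc; first by case: nc.
by have [h|/IH//] := pselect (chain m B A c); exists c.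
Qed.

(* The bound of Boratynski, Eisenbud and Rees for the number of generators of
   I^(n+1).  With E = (xs)^(n+1), split I^(n+1)/m I^(n+1) at E: the part above E
   has length at most that of R/(y R + E), as for any ideal of the
   one-dimensional ring R/E. *)
Lemma number_of_generators I y xs n l : is_ideal I -> ideal_sub I m ->
  (forall x, x \in y :: xs -> I x) -> ~ chain m (span (y :: xs)) whole l.+1 ->
  ~ chain m (ideal_mul m (ideal_pow I n.+1)) (ideal_pow I n.+1)
    (l * 'C(n + size xs, size xs) + 'C(n + size xs, n.+1)).+1.
Proof.
move=> hI Im hxs nl; set G := ideal_pow I n.+1; pose E := ideal_pow (span xs) n.+1.
have hG : is_ideal G by exact: pow_ideal.
have hE : is_ideal E by exact: pow_ideal.
have hmG : is_ideal (ideal_mul m G) by exact: mul_ideal.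
have Iy : I y by apply: hxs; exact: mem_head.
have EG : ideal_sub E G.
  apply: pow_mono; apply: span_min => // z hz; apply: hxs; by rewrite inE hz orbT.
have hD := isum_ideal hmG hE.
(* G has finite colength because it contains a power of (y, xs). The exact value k is needed for a
   cancellation below. *)
have [N nN] : exists c, ~ chain m G whole c.
  have h0 := span_ideal (R := R) [::].
  exists (l * 'C(n + size (y :: xs), size (y :: xs))).+1 => ch.
  apply: (@length_power (y :: xs) n l (span [::])) => //.
    by move=> ch'; apply: nl; apply: chain_anti ch'; apply: isumr.
  apply: chain_anti ch; apply: isum_min => //; first by apply: span_min.
  by apply: pow_mono; apply: span_min.
have [k ck nck] := exact_length (fun x _ => Logic.I) nN.
rewrite addnC; apply: (length_add hD hG).
- exact: isuml.
- by apply: isum_min => //; exact: mul_subr.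
- have [s [sz sin ssub]] := power_generators xs n.
  move=> ch; apply: (@length_span (ideal_mul m G) s hmG).
    by move=> z /sin/EG hz _ [u hu ->]; rewrite mulrC; apply: mul_in.
  by rewrite sz; apply: chain_mono ch; apply: isum_mono.
move=> ch.
have hyG := imul_elt_ideal y hG; have hyR := principal_ideal y.
have {ch} ch : chain m (isum (imul_elt y G) E) G (l * 'C(n + size xs, size xs)).+1.
  apply: chain_anti ch; apply: isum_mono => // _ [v hv ->].
  by apply: mul_in => //; exact: Im.
(* R/(yG + E) is measured through G and again through yR + E. As (yR + E)/(yG + E) is a quotient of
   R/G, the length k of R/G cancels. *)
have := chain_cat ch ck; rewrite addSn addnC.
have sub : ideal_sub (isum (imul_elt y G) E) (isum (principal y) E).
  by apply: isum_mono => // _ [v hv ->]; exists v.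
have hM := isum_ideal hyR hE; have hB := isum_ideal hyG hE.
apply: (length_add hM (whole_ideal _)) => //.
  have h : ideal_sub (isum (principal y) E) (sat m (isum (isum (imul_elt y G) E) (principal y))).
    apply: sub_trans (sat_sub max_prime); apply: isum_min.
    - exact: isum_ideal.
    - exact: isumr.
    - apply: sub_trans (isumr hyG) _; exact: isuml.
  move=> /(chain_colon max_prime hM h) ch'; apply: nck.
  apply: chain_mono (chain_anti _ ch') => // v hv.
  by apply: isuml => //; exists v => //; rewrite mulrC.
apply: length_power => // ch'; apply: nl; apply: chain_anti ch'; exact: span_cons.
Qed.

(** Here d = e + 1 and l = k + 2. After Pascal's rule the claim is k C(n+e, e) < C(n+e, e+1). Since
    (e+1) C(n+e, e+1) = n C(n+e, e), this means (e+1) k < n, and the chosen n is the least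
    solution. *)
Lemma generators_binomial e k (n := (e.+1 * k).+1) :
  ((k.+2 * 'C(n + e, e) + 'C(n + e, n.+1)).+1 <= 'C(n.+1 + e.+1, e.+1))%N.
Proof.
have E : ('C(n.+1 + e.+1, e.+1) =
          'C(n + e, e.+1) + 'C(n + e, e) + 'C(n + e, e) + 'C(n + e, n.+1))%N.
  rewrite addSn addnS binS [X in (X + _)%N]binS -[in RHS]addnA; congr (_ + _)%N.
  case: e n => [|e] n; first by rewrite !bin0 addn0 bin_small.
  rewrite binS; congr (_ + _)%N; rewrite -bin_sub; last by rewrite addnS -addSn leq_addl.
  by congr 'C(_, _); rewrite -addSnnS addnK.
rewrite {}E -addSn leq_add2r -[k.+2]addn2 mulnDl mul2n -addnn addnA -2!addSn !leq_add2r.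
rewrite -(ltn_pmul2l (ltn0Sn e)) mulnA mul_bin_left addnK ltn_pmul2r //.
by rewrite bin_gt0 leq_addl.
Qed.

End Local.

(** * The theorem of Eakin and Sathaye *)

Section Generic.
Variables (R : comNzRingType) (m : R -> Prop).
Hypotheses (noeth : noetherian R) (loc : local_with_max m) (infm : infinite_residue m).
Implicit Types (A B D K I N : R -> Prop) (x y t : R) (s xs : seq R) (c k l : nat).
Implicit Types (z a b : nat -> R) (U : (nat -> R) -> Prop).

Definition avoids s t : Prop := forall y, y \in s -> ~ m (t - y).

(* A substitute for Zariski-open sets of tuples of elements of I: a line that
   meets U meets it for all but finitely many residue classes of the parameter. *)
Definition line_open I U : Prop :=
  forall a b, (forall i, I (a i)) -> (forall i, I (b i)) -> U a ->
  exists s, forall t, avoids s t -> U (fun i => a i + t * b i).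

Lemma avoids_cat s s' t : avoids (s ++ s') t -> avoids s t /\ avoids s' t.
Proof. by move=> h; split=> y hy; apply: h; rewrite mem_cat hy ?orbT. Qed.

Lemma line_open_all I (Us : seq ((nat -> R) -> Prop)) :
  (forall U, List.In U Us -> line_open I U) ->
  line_open I (fun z => forall U, List.In U Us -> U z).
Proof.
elim: Us => [|U Us IH] h a b Ia Ib Ua; first by exists [::].
have [|s hs] := IH (fun V hV => h V (or_intror hV)) a b Ia Ib.
  by move=> V hV; apply: Ua; right.
have [s' hs'] := h U (or_introl erefl) a b Ia Ib (Ua U (or_introl erefl)).
by exists (s ++ s') => t /avoids_cat[t1 t2] V [<-|hV]; [exact: hs' | exact: hs].
Qed.

(** Join a point of U to a point of the other conditions by a line. Each side excludes finitely many
    residue classes of the parameter, which is t from one end and 1 - t from the other. *)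
Lemma generic_point I (Us : seq ((nat -> R) -> Prop)) : is_ideal I ->
  (forall U, List.In U Us -> line_open I U /\ exists2 a, (forall i, I (a i)) & U a) ->
  exists2 z, (forall i, I (z i)) & forall U, List.In U Us -> U z.
Proof.
move=> hI; elim: Us => [|U Us IH] h; first by exists (fun=> 0) => // i; exact: id0.
have [|b Ib hb] := IH; first by move=> V hV; apply: h; right.
have [oU [a Ia Ua]] := h U (or_introl erefl).
have oV : line_open I (fun z => forall U, List.In U Us -> U z).
  by apply: line_open_all => V hV; have [] := h V (or_intror hV).
have [s hs] := oU a (fun i => b i - a i) Ia (fun i => idB hI (Ib i) (Ia i)) Ua.
have [s' hs'] := oV b (fun i => a i - b i) Ib (fun i => idB hI (Ia i) (Ib i)) hb.
have [t ht] := infm (s ++ [seq 1 - y | y <- s']); have [t1 t2] := avoids_cat ht.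
exists (fun i => a i + t * (b i - a i)) => [i|V [<-|hV]].
- by apply: idD => //; apply: idMl => //; apply: idB.
- exact: hs.
have -> : (fun i => a i + t * (b i - a i)) = (fun i => b i + (1 - t) * (a i - b i)).
  by apply: funext => i; ring.
apply: hs' => // y hy mt; apply: (t2 (1 - y)); first by apply: map_f.
have [hm _ _] := loc; have -> : t - (1 - y) = - (1 - t - y) by ring.
exact: idN.
Qed.

(** The root count over the residue field, carried out in R[X]: if p(y) is in m, then p - p(y) is
    divisible by X - y, and the quotient has smaller degree. *)
Lemma roots_mod_finite (p : {poly R}) x : ~ m p.[x] ->
  exists s, forall t, avoids s t -> ~ m p.[t].
Proof.
have [hm m1 mM] := max_prime loc.
have [n hn] := ubnP (size p); elim: n p hn => // n IH p hp npx.
have [[y my]|no] := pselect (exists y, m p.[y]); last first.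
  by exists [::] => t _ mt; apply: no; exists t.
have /factor_theorem[q eq] : root (p - p.[y]%:P) y by rewrite rootE !hornerE subrr.
have ev t : p.[t] = q.[t] * (t - y) + p.[y].
  by rewrite -[p in LHS](subrK p.[y]%:P) eq !hornerE.
have nqx : ~ m q.[x].
  by move=> h; apply: npx; rewrite ev; apply: idD => //; apply: idMr.
have p0 : p != 0 by apply/eqP => e; apply: npx; rewrite e horner0; exact: id0.
have q0 : q != 0 by apply/eqP => e; apply: nqx; rewrite e horner0; exact: id0.
have [|s hs] := IH q _ nqx.
  have : (size (p - p.[y]%:P)%R <= size p)%N.
    apply: leq_trans (size_polyD _ _) _; rewrite geq_max leqnn size_polyN /=.
    by apply: leq_trans (size_polyC_leq1 _) _; rewrite size_poly_gt0.
  rewrite eq size_Mmonic ?monicXsubC // size_XsubC addn2 /= => h.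
  by rewrite -ltnS; apply: leq_ltn_trans h _.
exists (y :: s) => t ht; rewrite ev => /(fun h => idDr hm h my) /mM[].
  by apply: hs => z hz; apply: ht; rewrite inE hz orbT.
by apply: ht; exact: mem_head.
Qed.

Lemma complement_line_open I P : is_prime_ideal P -> line_open I (fun z => ~ P (z 0%N)).
Proof.
move=> pP a b _ _ na; have [hP P1 PM] := pP; have Pm := max_unique loc pP.
have [[t0 h0]|no] := pselect (exists t, P (a 0%N + t * b 0%N)); last first.
  by exists [::] => t _ h; apply: no; exists t.
exists [:: t0] => t ht h; apply: na.
have : P ((t - t0) * b 0%N).
  have -> : (t - t0) * b 0%N = (a 0%N + t * b 0%N) - (a 0%N + t0 * b 0%N) by ring.
  exact: idB.
move=> /PM[/Pm|hb]; first by move=> h'; case: (ht t0); rewrite ?inE.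
by apply: idDr h0 _ => //; apply: idMl.
Qed.

(** The ideal (z_0, ..., z_(r-1)) N. Tuples are infinite sequences read up to r, so that one type
    serves every r in the induction. *)
Definition zmul z r N : R -> Prop :=
  gen_ideal (fun x => exists i n, [/\ (i < r)%N, N n & x = z i * n]).

Lemma zmul_in z r N i n : (i < r)%N -> N n -> zmul z r N (z i * n).
Proof. by move=> hi hn; apply: gen_ideal_sub; exists i, n. Qed.
Lemma zmul_ideal z r N : is_ideal (zmul z r N). Proof. exact: gen_ideal_ideal. Qed.
Lemma zmul_min z r N A : is_ideal A -> (forall i n, (i < r)%N -> N n -> A (z i * n)) ->
  ideal_sub (zmul z r N) A.
Proof. by move=> hA h; apply: gen_ideal_min => // _ [i [n [hi hn ->]]]; exact: h. Qed.
Lemma zmul_span z r N : ideal_sub (zmul z r N) (ideal_mul (span (mkseq z r)) N).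
Proof.
apply: zmul_min; first exact: mul_ideal.
move=> i n hi hn; apply: mul_in => //; apply: span_in.
by apply/mapP; exists i; rewrite ?mem_iota.
Qed.

(* If the elements s_j = g a_i n generate g I N modulo B, then moving along the line
   a + t b replaces the column s by (1 + t M) s modulo B, and det (1 + t M) is 1 at
   t = 0, hence a unit unless t is in one of finitely many residue classes. *)
Lemma span_line_open I N B (g : R) r k : is_ideal I -> is_ideal N -> is_ideal B ->
  ~ chain m B (isum (imul_elt g (ideal_mul I N)) B) k ->
  line_open I (fun z => forall x, ideal_mul I N x ->
                 isum (imul_elt g (zmul z r N)) B (g * x)).
Proof.
move=> hI hN hB nch a b Ia Ib Ua.
have [hm m1 mM] := max_prime loc.
have hgIN : is_ideal (imul_elt g (ideal_mul I N)) by apply: imul_elt_ideal; exact: mul_ideal.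
pose gen p := g * (a p.1 * p.2) : R.
pose ok (p : nat * R) := (p.1 < r)%N /\ N p.2.
pose T x := exists2 p, ok p & x = gen p.
(* The generators are taken among the products g a_i n themselves, so that each moves along the line
   to g z_i n. *)
have [| |s [sT _ Ts]] := greedy_generators loc (T := T) hB (isum_ideal hgIN hB) _ _ nch.
- exact: isumr.
- move=> _ [p [_ hp] ->]; apply: isuml => //.
  by exists (a p.1 * p.2) => //; apply: mul_in.
have [ps es hps] := lift_seq sT.
have hs := isum_ideal (span_ideal s) hB.
have all_s x : ideal_mul I N x -> isum (span s) B (g * x).
  move=> /Ua; apply: isum_min => //; last by apply: isumr; exact: span_ideal.
  move=> _ [v hv ->]; rewrite mulrC.
  apply: (zmul_min (colon_ideal g hs) _ hv) => i n hi hn.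
  by rewrite /colon mulrC; apply: Ts; exists (i, n).
pose n := size s; pose p (i : 'I_n) := nth (0%N, 0) ps i.
have sps : size ps = n by rewrite /n es size_map.
have okp i : ok (p i) by apply: hps; apply: mem_nth; rewrite sps.
have su (i : 'I_n) : s`_i = gen (p i) by rewrite {1}es (nth_map (0%N, 0)) ?sps.
have /choice[M hM] (i : 'I_n) : exists e : 'I_n -> R,
    B (g * (b (p i).1 * (p i).2) - \sum_j e j * s`_j).
  have [_ hp] := okp i.
  have [v [w [/mul_span/(mul_span_comb (whole_ideal _))[e _ ->] hw ->]]] :=
     all_s _ (mul_in (Ib (p i).1) hp).
  by exists e; rewrite addrAC subrr add0r.
pose Mp : 'M[{poly R}]_n := \matrix_(i, j) ((i == j)%:R + 'X * (M i j)%:P).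
have evM t : (\det Mp).[t] = \det (\matrix_(i, j) ((i == j)%:R + t * M i j)).
  rewrite -horner_evalE -det_map_mx; congr (\det _); apply/matrixP => i j.
  rewrite !mxE /= /horner_eval; case: (i == j); by rewrite !hornerE.
have [|bad hbad] := @roots_mod_finite (\det Mp) 0.
  rewrite evM; have -> : \matrix_(i, j) ((i == j)%:R + 0 * M i j) = 1%:M.
    by apply/matrixP => i j; rewrite !mxE mul0r addr0.
  by rewrite det1.
exists bad => t /hbad; rewrite evM => nd.
pose z i := a i + t * b i; pose K := isum (imul_elt g (zmul z r N)) B.
have hgz : is_ideal (imul_elt g (zmul z r N)) by apply: imul_elt_ideal; exact: zmul_ideal.
have hK : is_ideal K by apply: isum_ideal.
have Ks (i : 'I_n) : K s`_i.
  apply: (local_saturated loc hK nd); apply: (cramer (g := fun j => s`_(val j)) hK) => {}i.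
  have [hp1 hp2] := okp i.
  under eq_bigr => j _ do rewrite mxE mulrDl -mulrA.
  rewrite big_split /= -mulr_sumr (bigD1 i) //= eqxx mul1r big1 ?addr0; last first.
    by move=> j ji; rewrite eq_sym (negbTE ji) mul0r.
  set sum := \sum_j _.
  have -> : s`_i + t * sum = g * (z (p i).1 * (p i).2)
              - t * (g * (b (p i).1 * (p i).2) - sum).
    rewrite su /gen /z; ring.
  apply: idB => //.
    by apply: isuml => //; exists (z (p i).1 * (p i).2) => //; apply: zmul_in.
  by apply: idMl => //; apply: isumr => //; exact: hM.
move=> x /all_s; apply: isum_min => //; last exact: isumr.
apply: span_min => // y hy; have hi : (index y s < n)%N by rewrite index_mem.
by rewrite -(nth_index 0 hy); exact: (Ks (Ordinal hi)).
Qed.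

(* The theorem of Eakin and Sathaye, for the graded module with components
   (g I^k + B k)/(B k).  If some y in I makes the quotient by y small, use the
   induction on r for that quotient; otherwise multiplication by each y in I has
   a small image, and the tuples given by the induction on n for a set of
   generators y of I can be chosen to be the same. *)
Lemma eakin_sathaye I (r n : nat) (g : R) (B : nat -> R -> Prop) : is_ideal I ->
  (forall k, is_ideal (B k)) ->
  (forall k x y, I x -> B k y -> B k.+1 (x * y)) ->
  (forall k x y, m x -> ideal_pow I k y -> B k (g * (x * y))) ->
  ~ chain m (B n.+1) (isum (imul_elt g (ideal_pow I n.+1)) (B n.+1)) 'C(n.+1 + r, r) ->
  exists2 z, (forall i, I (z i)) & forall x, ideal_pow I n.+1 x ->
    isum (imul_elt g (zmul z r (ideal_pow I n))) (B n.+1) (g * x).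
Proof.
move=> hI; have hpow := pow_ideal I.
elim: r n g B => [|r IHr] n g B hB IB mB.
  rewrite bin0 => nch; exists (fun=> 0) => [i|x hx]; first exact: id0.
  apply: isumr; first by apply: imul_elt_ideal; exact: zmul_ideal.
  apply: contrapT => nx; apply: nch; exists (B n.+1); split=> //.
  - exact: local_saturated.
  - by apply: isumr; apply: imul_elt_ideal.
  - by move=> h; apply: nx; apply: h; apply: isuml => //; exists x.
elim: n g B hB IB mB => [|n IHn] g B hB IB mB.
  (* The binomial is r + 2, so at most r + 1 elements are chosen; the default value 0 keeps the rest
     of the sequence in I. *)
  rewrite add1n binSn => nch.
  have hg1 : is_ideal (imul_elt g (ideal_pow I 1)) by exact: imul_elt_ideal.
  pose T x := exists2 y, I y & x = g * y.
  have [| |s [sT sz Ts]] := greedy_generators loc (T := T) (hB 1%N)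
    (isum_ideal hg1 (hB 1%N)) _ _ nch.
  - exact: isumr.
  - move=> _ [y hy ->]; apply: isuml => //; exists y => //.
    by rewrite -[y]mulr1; apply: mul_in.
  have [ys es hys] := lift_seq sT.
  exists (nth 0 ys) => [i|x /(mul_subl hI) hx].
    have [hi|hi] := ltnP i (size ys); first by apply: hys; exact: mem_nth.
    by rewrite nth_default //; exact: id0.
  have : T (g * x) by exists x.
  have hz : is_ideal (imul_elt g (zmul (nth 0 ys) r.+1 whole)).
    by apply: imul_elt_ideal; exact: zmul_ideal.
  move=> /Ts; apply: isum_min; [exact: isum_ideal| |exact: isumr].
  apply: span_min => [|w]; first exact: isum_ideal.
  rewrite es => /mapP[y hy ->]; apply: isuml => //; exists y => //.
  rewrite -(nth_index 0 hy) -[nth _ _ _]mulr1; apply: zmul_in => //.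
  by apply: (@leq_trans (size ys)); [rewrite index_mem | move: sz; rewrite es size_map].
move=> nch.
pose top := isum (imul_elt g (ideal_pow I n.+2)) (B n.+2).
(* These components define the quotient of the graded module by its multiples of y, which has degree
   one; hence the shift of k. *)
pose By y k := if k is k'.+1 then isum (imul_elt (g * y) (ideal_pow I k')) (B k) else B 0%N.
have hgy y k : is_ideal (imul_elt (g * y) (ideal_pow I k)) by exact: imul_elt_ideal.
have hBy y k : is_ideal (By y k) by case: k => [|k] //=; apply: isum_ideal.
have [[y [Iy ny]]|all] := pselect (exists y, I y /\ ~ chain m (By y n.+2) top 'C(n.+2 + r, r)).
  have [| | | z Iz hz] := IHr n.+1 g (By y) (hBy y).
  - move=> [|k] x b Ix; first by move=> h; apply: isumr => //; exact: IB.
    move=> [_ [b' [[v hv ->] hb ->]]]; rewrite mulrDr.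
    exists (x * (g * y * v)), (x * b'); split=> //; last exact: IB.
    by exists (x * v); [exact: mul_in | rewrite mulrCA].
  - by move=> [|k] x v mx hv; [exact: mB | apply: isumr => //; exact: mB].
  - move=> ch; apply: ny; apply: chain_mono ch; apply: isum_min.
    + by apply: isum_ideal => //; apply: imul_elt_ideal.
    + exact: isuml.
    apply: isum_mono => // _ [v hv ->]; exists (y * v); last by rewrite mulrA.
    exact: mul_in.
  exists (fun i => if i is j.+1 then z j else y) => [[|i]//|x /hz].
  set z' := fun i => _.
  have hz' : is_ideal (imul_elt g (zmul z' r.+1 (ideal_pow I n.+1))).
    by apply: imul_elt_ideal; exact: zmul_ideal.
  apply: isum_min; first exact: isum_ideal.
    apply: sub_trans (isuml (hB _)) => _ [v hv ->]; exists v => //.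
    apply: (zmul_min (zmul_ideal _ _ _) _ hv) => i w hi hw.
    exact: (@zmul_in z' _ _ i.+1).
  apply: isum_min; [exact: isum_ideal| |exact: isumr].
  move=> _ [v hv ->]; apply: isuml => //; exists (y * v); last by rewrite mulrA.
  exact: (@zmul_in z' _ _ 0%N).
(* By Pascal's rule a chain of this length, followed by one from [By y n.+2] to [top], would have
   the forbidden length. *)
have short y : I y -> ~ chain m (B n.+2)
    (isum (imul_elt (g * y) (ideal_pow I n.+1)) (B n.+2)) 'C(n.+1 + r.+1, r.+1).
  move=> Iy ch; apply: nch; have [|ch'] := pselect (chain m (By y n.+2) top 'C(n.+2 + r, r)).
    move=> ch'.
    have -> : 'C(n.+2 + r.+1, r.+1) = ('C(n.+1 + r.+1, r.+1) + 'C(n.+2 + r, r))%N.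
      by rewrite addnS binS addnS.
    exact: (chain_cat (C := By y n.+2) ch ch').
  by case: all; exists y.
have [es eI] := ideal_span noeth hI.
pose Uy y z := forall x, ideal_pow I n.+1 x ->
    isum (imul_elt (g * y) (zmul z r.+1 (ideal_pow I n))) (B n.+2) (g * y * x).
have [|z Iz hz] := @generic_point I (map Uy es) hI.
  move=> V hV; have [y hy ->] := List_In_map hV; have Iy : I y by rewrite eI; exact: span_in.
  split; first exact: (span_line_open hI (hpow n) (hB _) (short y Iy)).
  (* The submodule of multiples of y has its degree k part in degree k + 1, whence the shift of
     B. *)
  have [| | | |z Iz hz] := IHn (g * y) (fun k => B k.+1).
  - by [].
  - by move=> k x b; exact: IB.
  - move=> k x v mx hv; have -> : g * y * (x * v) = g * (x * (y * v)) by ring.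
    by apply: mB => //; exact: mul_in.
  - exact: short.
  by exists z.
exists z => //; set K := isum _ _.
have hK : is_ideal K.
  by apply: isum_ideal => //; apply: imul_elt_ideal; exact: zmul_ideal.
have hKg : is_ideal (colon K g) by exact: colon_ideal.
suff h : ideal_sub (ideal_pow I n.+2) (colon K g) by move=> x /h; rewrite /colon mulrC.
apply: mul_min => // e w he hw; rewrite eI in he.
apply: (span_min (colon_ideal w hKg) _ he) => {e he} e he.
have -> : colon (colon K g) w e = K (g * e * w).
  by rewrite /colon; congr (K _); ring.
have := hz _ (List_map_In Uy he) _ hw; apply: isum_mono => // _ [v hv ->].
exists (e * v); last by rewrite mulrA.
rewrite mulrC; apply: (zmul_min (colon_ideal e (zmul_ideal _ _ _)) _ hv) => i u hi hu.
rewrite /colon -mulrA [u * e]mulrC.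
apply: zmul_in => //; apply: mul_in => //; rewrite eI; exact: span_in.
Qed.

(** Eakin and Sathaye's theorem is used with g = 1 and B k = m I^k, and Nakayama then removes the
    term in m. The general form serves both I with generators of J, and J with powers of
    parameters. *)
Lemma reduction_exists I xs k : is_ideal I -> ideal_sub I m ->
  (forall x, x \in xs -> I x) -> (0 < size xs)%N -> ~ chain m (span xs) whole k.+3 ->
  exists s, [/\ size s = size xs, forall x, x \in s -> I x &
    ideal_sub (ideal_pow I (size xs * k).+2)
      (ideal_mul (span s) (ideal_pow I (size xs * k).+1))].
Proof.
move=> hI Im; case: xs => // y xs hxs _ nl; set d := size _.
have hpow := pow_ideal I; have hmul k := mul_ideal m (ideal_pow I k).
have := number_of_generators loc (n := (d * k).+1) hI Im hxs nl.
move=> h; set n := (d * k).+1; pose G := ideal_pow I n.+1.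
have [| |ch|z Iz hz] := @eakin_sathaye I d n 1 (fun k => ideal_mul m (ideal_pow I k)) hI hmul.
- move=> i x b Ix hb; apply: mulA_sub'; apply: (mul_mono (@mulC_sub _ _ _) (@sub_refl _ _)).
  by apply: mulA_sub; apply: mul_in.
- by move=> i x v mx hv; rewrite mul1r; apply: mul_in.
- apply: h; apply: chain_trunc (generators_binomial (size xs) k) _.
  apply: chain_mono ch; apply: isum_min => //; last exact: mul_subr.
  by move=> _ [v hv ->]; rewrite mul1r.
exists (mkseq z d); split.
- by rewrite size_mkseq.
- by move=> x /mapP[i _ ->].
apply: (nakayama noeth loc) => //; first exact: mul_ideal.
move=> x /hz; rewrite mul1r => -[_ [v [[u hu ->] hv ->]]]; rewrite mul1r addrC.
by exists v, u; split=> //; exact: zmul_span.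
Qed.
End Generic.

(** * Minimal reductions *)

Section Reductions.
Variables (R : comNzRingType) (m : R -> Prop).
Hypotheses (noeth : noetherian R) (loc : local_with_max m).
Implicit Types (A B I J P Q : R -> Prop) (x y : R) (s xs : seq R) (d k l n r : nat).

Lemma ideal_chain_of_chain J A n : is_ideal A -> chain m J A n ->
  exists C : nat -> R -> Prop, ideal_chain_over J C n /\ C n = A.
Proof.
elim: n A => [|n IH] A hA; first by move=> JA; exists (fun=> A).
move=> [A' [hA' _ s ns /(IH _ hA')[C [[h0 h1 h2] e]]]].
exists (fun i => if (i <= n)%N then C i else A); rewrite ltnn; split=> //; split=> // i hi.
  by case: ifP => // h; exact: h0.
rewrite -ltnS hi; case: ifP => h; first exact: h2.
have -> : i = n by apply/eqP; rewrite eqn_leq -ltnS hi leqNgt h.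
by rewrite e.
Qed.

Lemma krull_dim_height d : krull_dim R d -> height_ge m d /\ ~ height_ge m d.+1.
Proof.
move=> [[C hC] no]; split.
  have h := chain_height hC.
  exact: height_mono (max_prime loc) (max_unique loc (height_prime h)) h.
by move=> /height_chain[D [hD _]]; apply: no; exists D.
Qed.

(** Primes over the first i elements are kept of height at least i; for i = d such a prime is m, or
    m would have height d + 1. The next element avoids the primes of [Ps] that do not contain m,
    with [generic_point] in the place of prime avoidance. *)
Lemma system_of_parameters d : infinite_residue m ->
  height_ge m d -> ~ height_ge m d.+1 ->
  exists xs, [/\ size xs = d, forall x, x \in xs -> m x &
    forall P, is_prime_ideal P -> (forall x, x \in xs -> P x) -> ideal_sub m P].
Proof.
move=> infm hm nhm; have pm := max_prime loc; have [im _ _] := pm.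
suff [xs [sz mxs hxs]] : exists xs, [/\ size xs = d, forall x, x \in xs -> m x &
    forall P, is_prime_ideal P -> (forall x, x \in xs -> P x) -> height_ge P d].
  exists xs; split=> // P pP xsP; apply: contrapT => ns; apply: nhm; split=> //.
  by exists P; split=> //; [exact: max_unique | exact: hxs].
suff: forall i, (i <= d)%N -> exists xs, [/\ size xs = i, forall x, x \in xs -> m x &
    forall P, is_prime_ideal P -> (forall x, x \in xs -> P x) -> height_ge P i].
  by apply.
elim=> [|i IH] hi; first by exists [::].
have [xs [sz mxs hxs]] := IH (ltnW hi).
have [Ps [pPs minP]] := primes_over_finite noeth (span_ideal xs).
pose U P (z : nat -> R) := ~ ideal_sub m P -> ~ P (z 0%N).
have [|z mz hz] := generic_point loc infm (I := m) (Us := map U Ps) im.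
  move=> V /List.in_map_iff[P [<- /pPs pP]].
  have [s|ns] := pselect (ideal_sub m P).
    split; first by move=> a b _ _ _; exists [::] => t _ /(_ s).
    by exists (fun=> 0) => [_|/(_ s)//]; exact: id0.
  split; last by have [x mx nx] := not_sub ns; exists (fun=> x).
  move=> a b Ia Ib Ua.
  have [s hs] := complement_line_open loc pP Ia Ib (Ua ns).
  by exists s => t ht _; exact: hs.
exists (z 0%N :: xs); split; first by rewrite /= sz.
  by move=> x; rewrite inE => /orP[/eqP ->|/mxs].
move=> P pP hP; have [hPi _ _] := pP.
have Pxs x : x \in xs -> P x by move=> hx; apply: hP; rewrite inE hx orbT.
have [|P' [inP' xP' P'P]] := minP P pP; first exact: span_min.
have [s|ns] := pselect (ideal_sub m P').
  apply: (height_mono pP (sub_trans s P'P)); exact: height_trunc hi hm.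
split=> //; exists P'; split=> //.
  move=> s; have := hz _ (List.in_map U _ _ inP') ns; apply.
  by apply: s; apply: hP; exact: mem_head.
by apply: hxs; [exact: pPs | move=> x hx; apply: xP'; exact: span_in].
Qed.

Lemma replace_by_powers J xs : (forall x, x \in xs -> exists n, J (x ^+ n)) ->
  exists ys, [/\ size ys = size xs, forall y, y \in ys -> J y &
    forall P, is_prime_ideal P -> (forall y, y \in ys -> P y) -> forall x, x \in xs -> P x].
Proof.
elim: xs => [|x xs IH] h; first by exists [::].
have [|ys [sz Jys hys]] := IH; first by move=> y hy; apply: h; rewrite inE hy orbT.
have [n hn] := h x (mem_head _ _).
exists (x ^+ n :: ys); split; first by rewrite /= sz.
  by move=> y; rewrite inE => /orP[/eqP ->|/Jys].
move=> P pP hP y; rewrite inE => /orP[/eqP ->|hy].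
  by apply: (prime_pow (n := n) pP); apply: hP; exact: mem_head.
by apply: hys hy => // u hu; apply: hP; rewrite inE hu orbT.
Qed.

Lemma reductionP Q I r : is_ideal Q -> ideal_sub Q I ->
  ideal_sub (ideal_pow I r.+1) (ideal_mul Q (ideal_pow I r)) -> is_reduction Q I.
Proof. by move=> hQ QI h; split=> //; exists r => x; split; [exact: h | exact: mul_mono]. Qed.

Lemma reduction_power Q I r n :
  ideal_sub (ideal_pow I r.+1) (ideal_mul Q (ideal_pow I r)) ->
  ideal_sub (ideal_pow I (n + r)) (ideal_mul (ideal_pow Q n) (ideal_pow I r)).
Proof.
move=> h; elim: n => [|n IH] x; first by rewrite add0n => hx; rewrite -[x]mul1r; apply: mul_in.
move=> /(mul_mono (@sub_refl _ _) IH) /mulA_sub /(mul_mono (@mulC_sub _ _ _) (@sub_refl _ _)).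
move=> /mulA_sub' /(mul_mono (@sub_refl _ _) h) /mulA_sub.
exact: (mul_mono (@mulC_sub _ _ _) (@sub_refl _ _)).
Qed.

(** I^(n+1+r) lies in J^(n+1) I^r, hence in K J^n I^r, hence in K I^(n+r). *)
Lemma reduction_trans K J I n : is_ideal K -> ideal_sub K J ->
  ideal_sub (ideal_pow J n.+1) (ideal_mul K (ideal_pow J n)) ->
  is_reduction J I -> is_reduction K I.
Proof.
move=> hK KJ h [hJ JI [r hr]]; apply: (@reductionP K I (n + r)) => //.
  exact: sub_trans JI.
move=> x hx; have hr' : ideal_sub (ideal_pow I r.+1) (ideal_mul J (ideal_pow I r)) by move=> y /hr.
have := @reduction_power J I r n.+1 hr' x hx.
move=> /(mul_mono h (@sub_refl _ _)) /mulA_sub'.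
apply: mul_mono => // y /(mul_mono (pow_mono JI) (@sub_refl _ _)); exact: powD'.
Qed.

Lemma reduction_nilpotent Q I x : primary_to m I -> is_reduction Q I -> m x ->
  exists n, Q (x ^+ n).
Proof.
move=> [_ rad] [hQ _ [r hr]] /rad[n hn]; exists (n * r.+1)%N; rewrite exprM.
have /hr := pow_in r.+1 hn; exact: mul_subl.
Qed.

(* A smaller reduction would contain one with fewer generators, hence generating
   an m-primary ideal, against the height theorem. *)
Lemma reduction_minimal I s : primary_to m I -> height_ge m (size s) ->
  is_reduction (span s) I -> minimal_reduction (span s) I.
Proof.
move=> prI hm redQ; split=> // Q' redQ' Q'Q; have [hQ' Q'I [r hr]] := redQ'.
have [_ QI _] := redQ; have [hI rad] := prI.
have pm := max_prime loc; have [im _ _] := pm.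
have Im : ideal_sub I m by move=> x hx; apply/rad; exists 1%N.
have hG := span_ideal s; set G := span s in hG QI *.
have hmG := mul_ideal m G.
apply: contrapT => ns.
have hD := isum_ideal hmG hQ'.
have nGD : ~ ideal_sub G (isum (ideal_mul m G) Q').
  by move=> h; apply: ns; apply: (nakayama noeth loc) => //.
(* G/mG has dimension at most [size s], and by Nakayama the image of Q' in it is a proper
   subspace. *)
have nch : ~ chain m (ideal_mul m G) (isum (ideal_mul m G) Q') (size s).
  move=> ch; apply: (length_span loc (s := s) hmG).
    by move=> x hx _ [u hu ->]; rewrite mulrC; apply: mul_in => //; exact: span_in.
  exists (isum (ideal_mul m G) Q'); split=> //; first exact: local_saturated.
    by apply: isum_mono => //.
  by move=> h; apply: nGD; apply: sub_trans h; apply: isumr.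
have [| |w [wQ' sz hw]] := greedy_generators loc (T := Q') hmG hD _ _ nch.
- exact: isuml.
- exact: isumr.
have hK := mul_ideal (span w) (ideal_pow I r).
have hmI := mul_ideal m (ideal_pow I r.+1).
(* Q' lies in (w) + mG, so I^(r+1) lies in (w) I^r + m I^(r+1). *)
have hKw : ideal_sub (ideal_pow I r.+1) (ideal_mul (span w) (ideal_pow I r)).
  apply: (nakayama noeth loc) => //; first exact: pow_ideal.
  move=> x /hr; apply: mul_min => [|q v /hw[a [b [ha hb ->]]] hv]; first exact: isum_ideal.
  rewrite mulrDl addrC; exists (b * v), (a * v); split=> //; last exact: mul_in.
  apply: (mul_mono (@sub_refl _ _) (mul_mono QI (@sub_refl _ _))).
  by apply: mulA_sub'; exact: mul_in.
have redw : is_reduction (span w) I.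
  apply: reductionP hKw; first exact: span_ideal.
  by apply: span_min => // x /wQ'/Q'I.
apply: (@height_theorem R m w noeth pm); last exact: height_trunc sz hm.
- move=> P pP wP _ x /(reduction_nilpotent prI redw)[n hn].
  by apply: (prime_pow (n := n) pP); apply: span_min hn => //; have [] := pP.
- by move=> x /wQ'/Q'I/Im.
Qed.

Lemma minimal_reduction_number Q I r : ideal_sub Q I ->
  ideal_sub (ideal_pow I r.+1) (ideal_mul Q (ideal_pow I r)) ->
  exists2 k, reduction_number Q I k & (k <= r)%N.
Proof.
move=> QI h; pose F k := `[< ideal_eq (ideal_pow I k.+1) (ideal_mul Q (ideal_pow I k)) >].
have Fr : F r by apply/asboolP => x; split; [exact: h | exact: mul_mono].
have ex : exists k, F k by exists r.
case: (ex_minnP ex) => k /asboolP hk mk; exists k; last exact: mk.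
by split=> // j jk /asboolP /mk; rewrite leqNgt jk.
Qed.

(** The d elements found generate a reduction of J, hence one of I inside J, and minimality makes it
    all of J. Any bound c on the length of R/(ys) suffices. *)
Lemma minimal_reduction_generators d I J : infinite_residue m -> (0 < d)%N ->
  height_ge m d -> ~ height_ge m d.+1 -> primary_to m I -> minimal_reduction J I ->
  exists s, size s = d /\ J = span s.
Proof.
move=> infm d0 hm nhm prI [redJ minJ]; have [hJ JI _] := redJ; have [hI rad] := prI.
have Jm : ideal_sub J m by move=> x /JI hx; apply/rad; exists 1%N.
have pm := max_prime loc.
have [xs [szx mxs hxs]] := system_of_parameters infm hm nhm.
have [|ys [szy Jys hys]] := @replace_by_powers J xs.
  by move=> x /mxs mx; exact: (reduction_nilpotent prI redJ mx).
have [|c nc] := @finite_length R m (span ys) noeth pm (span_ideal ys).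
  move=> x; apply: (minimal_prime_nilp noeth pm (span_ideal ys)) => P pP ysP _.
  apply: hxs => // z; apply: hys => // y hy; apply: ysP; exact: span_in.
have [| |s [sz Js hs]] := reduction_exists noeth loc infm (k := c) hJ Jm Jys.
- by rewrite szy szx.
- by move=> ch; apply: nc; apply: chain_trunc ch; rewrite -addn3 leq_addr.
exists s; split; first by rewrite sz szy.
have sJ : ideal_sub (span s) J by exact: span_min.
apply/predeqP => x; split; last exact: sJ.
by apply: minJ => //; exact: (reduction_trans (span_ideal s) sJ hs redJ).
Qed.

End Reductions.

(* max{d*lambda(R/J) - 2d + 1, 0} is written with truncated nat subtraction *)
Theorem theorem3p3 (R : comNzRingType) (m I J : R -> Prop) (d l : nat) :
  noetherian R -> local_with_max m -> krull_dim R d -> (1 <= d)%N ->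
  infinite_residue m -> primary_to m I -> minimal_reduction J I ->
  length_quot J l ->
  exists Q : R -> Prop, minimal_reduction Q I /\
    exists r, reduction_number Q I r /\ (r <= d * l + 1 - 2 * d)%N.
Proof.
move=> noeth loc kd d0 infm prI minJ [_ nl].
have [hm nhm] := krull_dim_height loc kd; have [im m1 mx] := loc.
have [hI rad] := prI; have [[hJ JI _] _] := minJ.
have Im : ideal_sub I m by move=> x hx; apply/rad; exists 1%N.
have {}nl : ~ chain m J whole l.+1.
  by move=> /(ideal_chain_of_chain (whole_ideal _))[C [hC _]]; apply: nl; exists C.
have wm : ~ ideal_sub whole m by move=> h; apply: m1; exact: h.
have Jm := sub_trans JI Im.
(* The construction needs l = k + 2. Length 0 contradicts that J is inside m, and length 1 means J =
   I = m, where Q = J has reduction number 0. *)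
case: l nl => [|[|k]] nl.
- case: nl; exists m; split=> //; exact: local_saturated.
- have mJ : ideal_sub m J.
    apply: contrapT => ns; apply: nl; exists m; split=> //; first exact: local_saturated.
    by exists J; split=> //; exact: local_saturated.
  exists J; split=> //; have [|r hr r0] := @minimal_reduction_number _ J I 0 JI.
    by apply: mul_mono => //; exact: sub_trans mJ.
  by exists r; split=> //; apply: leq_trans r0 _.
have [s [sz eJ]] := minimal_reduction_generators noeth loc infm d0 hm nhm prI minJ.
have sI x : x \in s -> I x by move=> hx; apply: JI; rewrite eJ; exact: span_in.
have [| |q [szq qI hq]] := reduction_exists noeth loc infm (k := k) hI Im sI.
- by rewrite sz.
- by rewrite -eJ.
have QI : ideal_sub (span q) I by exact: span_min.
exists (span q); split.
  apply: (reduction_minimal noeth loc prI); first by rewrite szq sz.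
  exact: reductionP (span_ideal q) QI hq.
have [r hr rk] := minimal_reduction_number QI hq; exists r; split=> //.
(* The exponent d k + 1 equals d l + 1 - 2 d for l = k + 2. *)
by apply: leq_trans rk _; rewrite sz !mulnS addnA addnn -mul2n -addnA addKn addn1.
Qed.
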